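(* Let $C$ be a coalgebra and let $\mathcal{T}_e\subseteq\mathcal{M}^C$ be the localizing subcategory associated to an idempotent $e\in C^*$. The following conditions are equivalent: (a) $\mathcal{T}_e$ is a stable subcategory. (b) $T(E_x)=0$ for every $x\notin I_e$. (c) $T(E_x)=\overline{E}_x$ if $x\in I_e$, and $T(E_x)=0$ if $x\notin I_e$. (d) $\operatorname{Hom}_C(E_y,E_x)=0$ for all $x\in I_e$ and $y\notin I_e$. (e) Any torsion vertex in $\Gamma_C$ has no torsion-free predecessor. (f) $\mathcal{K}=\{S\in(\Gamma_C)_0 \mid T(S)=S\}$ is a right link-closed subset of $(\Gamma_C)_0$, i.e., there is no arrow $S_x\to S_y$ in $\Gamma_C$ with $T(S_x)=S_x$ and $T(S_y)=0$. (g) There is no path in $\Gamma_C$ from a vertex $S_x$ to a vertex $S_y$ such that $T(S_x)=S_x$ and $T(S_y)=0$. (h) $e$ is a left semicentral idempotent in $C^*$. If $\mathcal{T}_e$ is a colocalizing subcategory, these are also equivalent to (i) $H(S_x)=S_x$ for every $x\in I_e$.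
   Context: Let $K$ be a field and $C$ a basic $K$-coalgebra (the socle of the right $C$-comodule $C$ is a direct sum of pairwise non-isomorphic simple comodules). All comodules are right comodules and $\mathcal{M}^C$ is the category of right $C$-comodules. $\{S_x\}_{x\in I_C}$ is a complete set of pairwise non-isomorphic simple right $C$-comodules, and $E_x$ is the injective envelope of $S_x$. Equalities and inclusions between comodules such as $T(S_x)=S_x$ are understood up to isomorphism. The right Ext-quiver $\Gamma_C$ has vertex set $(\Gamma_C)_0=\{S_x\}_{x\in I_C}$ and a unique arrow $S_y\to S_x$ iff $\operatorname{Ext}^1_C(S_y,S_x)\neq 0$. It is assumed that $\Gamma_C$ is connected ($C$ is indecomposable as a coalgebra). A subset $\Lambda\subseteq(\Gamma_C)_0$ is right link-closed if for each arrow $S\to S'$ in $\Gamma_C$, $S\in\Lambda$ implies $S'\in\Lambda$. Loewy series of a comodule $M$: $\operatorname{Soc}^1M=\operatorname{Soc}M$ and $\operatorname{Soc}^nM/\operatorname{Soc}^{n-1}M=\operatorname{Soc}(M/\operatorname{Soc}^{n-1}M)$ for $n>1$. For $n\ge 1$, $S_y$ is an $n$-predecessor of $S_x$ if $\operatorname{Ext}^1_C(S_y,\operatorname{Soc}^nE_x)\ne 0$ (equivalently $S_y$ embeds in $\operatorname{Soc}(E_x/\operatorname{Soc}^nE_x)$); $S_y$ is a predecessor of $S_x$ if it is an $n$-predecessor for some $n\geq1$. For an idempotent $e\in C^*$, $e$ acts on a right comodule $M$ by $em=\sum m_{(0)}e(m_{(1)})$, and on $C$ by $ec=\sum c_{(1)}e(c_{(2)})$,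 $ce=\sum e(c_{(1)})c_{(2)}$. The space $eCe$ is a coalgebra with $\Delta(ece)=\sum ec_{(1)}e\otimes ec_{(2)}e$ and counit the restriction of that of $C$. The quotient functor is the exact functor $T:\mathcal{M}^C\to\mathcal{M}^{eCe}$, $T(M)=eM\cong M\square_C eC$. The localizing subcategory $\mathcal{T}_e$ is the class of $M$ with $T(M)=0$ (torsion comodules), and $\mathcal{M}^C/\mathcal{T}_e\simeq\mathcal{M}^{eCe}$. A comodule is torsion-free if its largest torsion subcomodule is zero. Put $I_e=\{x\in I_C: T(S_x)\neq0\}$; the comodules $T(S_x)=S_x$, $x\in I_e$, form a complete set of simple $eCe$-comodules, and $\overline{E}_x$ is the injective envelope of $S_x$ in $\mathcal{M}^{eCe}$. A vertex $S_x$ is torsion-free if $x\in I_e$ and torsion if $x\notin I_e$. $\mathcal{T}_e$ is stable if it is closed under injective envelopes. $e$ is left semicentral if $eC=eCe$ (equivalently, $eC$ is a subcoalgebra of $C$). $\mathcal{T}_e$ is colocalizing if $T$ has a left adjoint $H:\mathcal{M}^{eCe}\to\mathcal{M}^C$ (equivalently, $eC$ is a quasi-finite right $eCe$-comodule); then $H=\operatorname{Cohom}_{eCe}(eC,-)$. *)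

(* Defs.v *)
From Stdlib Require Import Relation_Operators.
From HB Require Import structures.
From mathcomp Require Import all_boot all_order all_algebra.
From mathcomp Require Import boolp classical_sets.

Set Implicit Arguments.
Unset Strict Implicit.
Unset Printing Implicit Defensive.

Import GRing.Theory.
Local Open Scope ring_scope.
Local Open Scope quotient_scope.

(* Tensor products: formal finite sums of pairs (v, w), two of them being
   identified when every bilinear map takes the same value on both. *)

Section TensorDef.
Variables (K : fieldType) (V W : lmodType K).

Definition tsum (U : lmodType K) (b : V -> W -> U) (s : seq (V * W)) : U :=
  \sum_(p <- s) b p.1 p.2.

Definition teq (s t : seq (V * W)) : bool :=
  `[< forall (U : lmodType K) (b : {bilinear V -> W -> U}),
      tsum b s = tsum b t >].

Lemma teq_equiv : equiv_class_of teq.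
Proof.
split=> [s|s t|t s u].
- exact/asboolP.
- by apply/asboolP/asboolP => h U b; rewrite h.
- move=> /asboolP h1 /asboolP h2; apply/asboolP => U b.
  by rewrite h1 h2.
Qed.

Canonical teq_equiv_rel := EquivRelPack teq_equiv.

Definition tensor := {eq_quot teq}.
HB.instance Definition _ : EqQuotient _ teq tensor := EqQuotient.on tensor.
HB.instance Definition _ := Choice.on tensor.

Definition tens (v : V) (w : W) : tensor := \pi_tensor [:: (v, w)].

Definition tlift (U : lmodType K) (b : {bilinear V -> W -> U}) (t : tensor) : U :=
  tsum b (repr t).

Lemma tlift_pi (U : lmodType K) (b : {bilinear V -> W -> U}) s :
  tlift b (\pi_tensor s) = tsum b s.
Proof.
have /eqmodP/asboolP h : \pi_tensor (repr (\pi_tensor s)) = \pi_tensor s.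
  by rewrite reprK.
exact: h.
Qed.

Lemma tlift_inj (x y : tensor) :
  (forall (U : lmodType K) (b : {bilinear V -> W -> U}),
      tlift b x = tlift b y) -> x = y.
Proof.
move=> h; rewrite -[x]reprK -[y]reprK; apply/eqmodP/asboolP => U b; exact: h.
Qed.

Definition tzero : tensor := \pi_tensor [::].
Definition tadd (x y : tensor) : tensor := \pi_tensor (repr x ++ repr y).
Definition tscale (a : K) (x : tensor) : tensor :=
  \pi_tensor [seq (a *: p.1, p.2) | p <- repr x].
Definition topp (x : tensor) : tensor := tscale (-1) x.

Section Lift.
Variables (U : lmodType K) (b : {bilinear V -> W -> U}).

Lemma tlift0 : tlift b tzero = 0.
Proof. by rewrite tlift_pi /tsum big_nil. Qed.

Lemma tliftD x y : tlift b (tadd x y) = tlift b x + tlift b y.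
Proof. by rewrite tlift_pi /tsum big_cat. Qed.

Lemma tliftZ a x : tlift b (tscale a x) = a *: tlift b x.
Proof.
rewrite tlift_pi /tsum big_map scaler_sumr; apply: eq_bigr => p _ /=.
by rewrite linearZl_LR.
Qed.

Lemma tlift_tens v w : tlift b (tens v w) = b v w.
Proof. by rewrite tlift_pi /tsum big_seq1. Qed.

End Lift.

Definition tliftE := (tliftZ, tliftD, tlift0).

Lemma taddA : associative tadd.
Proof. by move=> x y z; apply: tlift_inj => U b; rewrite !tliftE addrA. Qed.

Lemma taddC : commutative tadd.
Proof. by move=> x y; apply: tlift_inj => U b; rewrite !tliftE addrC. Qed.

Lemma tadd0 : left_id tzero tadd.
Proof. by move=> x; apply: tlift_inj => U b; rewrite !tliftE add0r. Qed.

Lemma taddN : left_inverse tzero topp tadd.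
Proof.
by move=> x; apply: tlift_inj => U b; rewrite !tliftE scaleN1r addNr.
Qed.

HB.instance Definition _ := GRing.isZmodule.Build tensor taddA taddC tadd0 taddN.

Lemma tscaleA a b (x : tensor) : tscale a (tscale b x) = tscale (a * b) x.
Proof. by apply: tlift_inj => U f; rewrite !tliftE scalerA. Qed.

Lemma tscale1 : left_id 1 tscale.
Proof. by move=> x; apply: tlift_inj => U f; rewrite !tliftE scale1r. Qed.

Lemma tscaleDr : right_distributive tscale +%R.
Proof.
by move=> a x y; apply: tlift_inj => U f; rewrite [_ + _]/(tadd _ _)
  [tscale a x + _]/(tadd _ _) !tliftE scalerDr.
Qed.

Lemma tscaleDl (x : tensor) : {morph tscale^~ x : a b / a + b}.
Proof.
by move=> a b; apply: tlift_inj => U f; rewrite [tscale a x + _]/(tadd _ _)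
  !tliftE scalerDl.
Qed.

HB.instance Definition _ := GRing.Zmodule_isLmodule.Build K tensor
  tscaleA tscale1 tscaleDr tscaleDl.

Lemma tlift_is_linear (U : lmodType K) (b : {bilinear V -> W -> U}) : linear (tlift b).
Proof.
by move=> a x y; rewrite [a *: x + y]/(tadd (tscale a x) y) !tliftE.
Qed.
HB.instance Definition _ (U : lmodType K) (b : {bilinear V -> W -> U}) :=
  GRing.isLinear.Build K tensor U _ (tlift b) (@tlift_is_linear U b).

Lemma tens_is_bilinear : bilinear_for *:%R *:%R tens.
Proof.
split=> [w|v] a x y; apply: tlift_inj => U b; rewrite linearP /= !tlift_tens.
  by rewrite linearPl.
by rewrite linearPr.
Qed.
HB.instance Definition _ := bilinear_isBilinear.Build K V W tensor
  *:%R *:%R tens tens_is_bilinear.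

Lemma tensor_sum (x : tensor) : x = \sum_(p <- repr x) tens p.1 p.2.
Proof.
apply: tlift_inj => U b; rewrite linear_sum /=.
by apply: eq_bigr => p _; rewrite tlift_tens.
Qed.

Lemma tensor_ext (U : lmodType K) (f g : {linear tensor -> U}) :
  (forall v w, f (tens v w) = g (tens v w)) -> f =1 g.
Proof.
move=> h x; rewrite [x]tensor_sum !linear_sum.
by apply: eq_bigr => p _; apply: h.
Qed.

End TensorDef.

Notation "V ⊗ W" := (tensor V W) (at level 40, left associativity) : type_scope.
Notation "v ⊗t w" := (tens v w) (at level 40, left associativity) : ring_scope.

Section TensorMaps.
Variable K : fieldType.
Implicit Types U V W : lmodType K.

Definition tmap_fun V W V' W' (f : {linear V -> V'}) (g : {linear W -> W'})
  (v : V) (w : W) : V' ⊗ W' := f v ⊗t g w.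
Lemma tmap_fun_bilinear V W V' W' (f : {linear V -> V'}) (g : {linear W -> W'}) :
  bilinear_for *:%R *:%R (tmap_fun f g).
Proof.
by split=> [w|v] a x y; rewrite /tmap_fun linearP ?linearPl ?linearPr.
Qed.
HB.instance Definition _ V W V' W' (f : {linear V -> V'}) (g : {linear W -> W'}) :=
  bilinear_isBilinear.Build K V W (V' ⊗ W') *:%R *:%R (tmap_fun f g)
    (tmap_fun_bilinear f g).
Definition tmap V W V' W' (f : {linear V -> V'}) (g : {linear W -> W'}) :
  {linear V ⊗ W -> V' ⊗ W'} := tlift (tmap_fun f g).

Definition tassoc_fun2 U V W (w : W) (u : U) (v : V) : U ⊗ (V ⊗ W) :=
  u ⊗t (v ⊗t w).
Lemma tassoc_fun2_bilinear U V W (w : W) :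
  bilinear_for *:%R *:%R (@tassoc_fun2 U V W w).
Proof.
by split=> [v|u] a x y; rewrite /tassoc_fun2 ?linearPl ?linearPr.
Qed.
HB.instance Definition _ U V W (w : W) :=
  bilinear_isBilinear.Build K U V (U ⊗ (V ⊗ W)) *:%R *:%R
    (@tassoc_fun2 U V W w) (@tassoc_fun2_bilinear U V W w).
Definition tassoc_fun U V W (t : U ⊗ V) (w : W) : U ⊗ (V ⊗ W) :=
  tlift (tassoc_fun2 w) t.
Lemma tassoc_fun_bilinear U V W :
  bilinear_for *:%R *:%R (@tassoc_fun U V W).
Proof.
split=> [w|t] a x y; rewrite /tassoc_fun ?linearP //.
move: t; apply: (tensor_ext (f := tlift (tassoc_fun2 (a *: x + y)))
  (g := (a \*: tlift (tassoc_fun2 x)) \+ tlift (tassoc_fun2 y))) => u v.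
transitivity (u ⊗t (v ⊗t (a *: x + y))); first exact: tlift_tens.
transitivity (a *: (u ⊗t (v ⊗t x)) + u ⊗t (v ⊗t y)).
  by rewrite linearPr /= linearPr.
by congr (_ *: _ + _); apply: esym; exact: tlift_tens.
Qed.
HB.instance Definition _ U V W :=
  bilinear_isBilinear.Build K (U ⊗ V) W (U ⊗ (V ⊗ W)) *:%R *:%R
    (@tassoc_fun U V W) (@tassoc_fun_bilinear U V W).
Definition tassoc U V W : {linear (U ⊗ V) ⊗ W -> U ⊗ (V ⊗ W)} :=
  tlift (@tassoc_fun U V W).

Definition tcontr_fun V W (f : {linear W -> K^o}) (v : V) (w : W) : V :=
  (f w : K) *: v.
Lemma tcontr_fun_bilinear V W (f : {linear W -> K^o}) :
  bilinear_for *:%R *:%R (@tcontr_fun V W f).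
Proof.
split=> [w|v] a x y; rewrite /tcontr_fun.
  by rewrite /= scalerDr !scalerA (mulrC a).
by rewrite /= linearP scalerDl scalerA.
Qed.
HB.instance Definition _ V W (f : {linear W -> K^o}) :=
  bilinear_isBilinear.Build K V W V *:%R *:%R
    (@tcontr_fun V W f) (@tcontr_fun_bilinear V W f).
Definition tcontr V W (f : {linear W -> K^o}) : {linear V ⊗ W -> V} :=
  tlift (@tcontr_fun V W f).

Definition tcontl_fun V W (f : {linear V -> K^o}) (v : V) (w : W) : W :=
  (f v : K) *: w.
Lemma tcontl_fun_bilinear V W (f : {linear V -> K^o}) :
  bilinear_for *:%R *:%R (@tcontl_fun V W f).
Proof.
split=> [w|v] a x y; rewrite /tcontl_fun.
  by rewrite /= linearP scalerDl scalerA.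
by rewrite /= scalerDr !scalerA (mulrC a).
Qed.
HB.instance Definition _ V W (f : {linear V -> K^o}) :=
  bilinear_isBilinear.Build K V W W *:%R *:%R
    (@tcontl_fun V W f) (@tcontl_fun_bilinear V W f).
Definition tcontl V W (f : {linear V -> K^o}) : {linear V ⊗ W -> W} :=
  tlift (@tcontl_fun V W f).

Arguments tmap : simpl never.
Arguments tassoc : simpl never.
Arguments tcontr : simpl never.
Arguments tcontl : simpl never.

Lemma tensor_ext3 U V W (X : lmodType K) (f g : {linear (U ⊗ V) ⊗ W -> X}) :
  (forall u v w, f (u ⊗t v ⊗t w) = g (u ⊗t v ⊗t w)) -> f =1 g.
Proof.
move=> h; apply: tensor_ext => x w.
rewrite [x]tensor_sum linear_sumlz !linear_sum.
by apply: eq_bigr => p _; apply: h.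
Qed.

Lemma tmapE V W V' W' (f : {linear V -> V'}) (g : {linear W -> W'}) v w :
  tmap f g (v ⊗t w) = f v ⊗t g w.
Proof. exact: tlift_tens. Qed.

Lemma tassocE U V W (u : U) (v : V) (w : W) :
  tassoc U V W (u ⊗t v ⊗t w) = u ⊗t (v ⊗t w).
Proof.
transitivity (tassoc_fun (u ⊗t v) w); first exact: tlift_tens.
exact: tlift_tens.
Qed.

Lemma tcontrE V W (f : {linear W -> K^o}) (v : V) w :
  tcontr V f (v ⊗t w) = (f w : K) *: v.
Proof. exact: tlift_tens. Qed.

Lemma tcontlE V W (f : {linear V -> K^o}) v (w : W) :
  tcontl W f (v ⊗t w) = (f v : K) *: w.
Proof. exact: tlift_tens. Qed.

Lemma tmap_comp V W V' W' V'' W'' (f : {linear V -> V'}) (g : {linear W -> W'})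
    (f' : {linear V' -> V''}) (g' : {linear W' -> W''}) t :
  tmap f' g' (tmap f g t) = tmap (f' \o f) (g' \o g) t.
Proof.
by move: t; apply: (tensor_ext (f := tmap f' g' \o tmap f g)) => v w /=;
  rewrite !tmapE.
Qed.

Lemma eq_tmap V W V' W' (f f' : {linear V -> V'}) (g g' : {linear W -> W'}) :
  f =1 f' -> g =1 g' -> tmap f g =1 tmap f' g'.
Proof. by move=> hf hg; apply: tensor_ext => v w; rewrite !tmapE hf hg. Qed.

Lemma tmap_addl V W V' W' (f g : {linear V -> V'}) (h : {linear W -> W'}) t :
  tmap (f \+ g) h t = tmap f h t + tmap g h t.
Proof.
move: t; apply: (tensor_ext (g := tmap f h \+ tmap g h)) => v w.
by rewrite [RHS]/= !tmapE linearDl.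
Qed.

Lemma tmap_id V W (f : {linear V -> V}) (g : {linear W -> W}) :
  f =1 id -> g =1 id -> tmap f g =1 id.
Proof.
move=> hf hg t; move: t.
by apply: (tensor_ext (g := idfun)) => v w; rewrite tmapE hf hg.
Qed.

Lemma tassoc_nat U V W U' V' W' (f : {linear U -> U'}) (g : {linear V -> V'})
    (h : {linear W -> W'}) t :
  tassoc _ _ _ (tmap (tmap f g) h t) = tmap f (tmap g h) (tassoc _ _ _ t).
Proof.
move: t; apply: (tensor_ext3 (f := tassoc _ _ _ \o tmap (tmap f g) h)
  (g := tmap f (tmap g h) \o tassoc _ _ _)) => u v w /=.
by rewrite !(tmapE, tassocE).
Qed.

Lemma tcontr_tmap V W V' W' (f : {linear V -> V'}) (g : {linear W -> W'})
    (e : {linear W' -> K^o}) t :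
  tcontr _ e (tmap f g t) = f (tcontr _ (e \o g) t).
Proof.
move: t; apply: (tensor_ext (f := tcontr _ e \o tmap f g)
  (g := f \o tcontr _ (e \o g))) => v w /=.
by rewrite tmapE !tcontrE linearZ.
Qed.

Lemma tcontl_tmap V W V' W' (f : {linear V -> V'}) (g : {linear W -> W'})
    (e : {linear V' -> K^o}) t :
  tcontl _ e (tmap f g t) = g (tcontl _ (e \o f) t).
Proof.
move: t; apply: (tensor_ext (f := tcontl _ e \o tmap f g)
  (g := g \o tcontl _ (e \o f))) => v w /=.
by rewrite tmapE !tcontlE linearZ.
Qed.

Lemma eq_tcontr V W (f g : {linear W -> K^o}) :
  f =1 g -> tcontr V f =1 tcontr V g.
Proof. by move=> h; apply: tensor_ext => v w; rewrite !tcontrE h. Qed.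

Lemma eq_tcontl V W (f g : {linear V -> K^o}) :
  f =1 g -> tcontl W f =1 tcontl W g.
Proof. by move=> h; apply: tensor_ext => v w; rewrite !tcontlE h. Qed.

Lemma tcontr_assoc U V W (e : {linear W -> K^o}) t :
  tcontr (U ⊗ V) e t = tmap idfun (tcontr V e) (tassoc _ _ _ t).
Proof.
move: t; apply: (tensor_ext3 (f := tcontr (U ⊗ V) e)
  (g := tmap idfun (tcontr V e) \o tassoc U V W)) => u v w /=.
by rewrite !(tmapE, tassocE, tcontrE) linearZr_LR.
Qed.

Lemma tcontl_assoc U V W (e : {linear U -> K^o}) t :
  tcontl (V ⊗ W) e (tassoc U V W t) = tmap (tcontl V e) idfun t.
Proof.
move: t; apply: (tensor_ext3 (f := tcontl (V ⊗ W) e \o tassoc U V W)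
  (g := tmap (tcontl V e) idfun)) => u v w /=.
by rewrite !(tmapE, tassocE, tcontlE) linearZl_LR.
Qed.

End TensorMaps.

Section Subspaces.
Variables (K : fieldType) (V : lmodType K).

Record subspace := Subspace {
  sub_mem :> V -> Prop;
  sub_mem0 : sub_mem 0;
  sub_memP : forall (a : K) u v, sub_mem u -> sub_mem v -> sub_mem (a *: u + v)
}.

Variable P : subspace.

Lemma sub_memZ a v : P v -> P (a *: v).
Proof. by move=> hv; rewrite -[_ *: _]addr0; apply: sub_memP => //; exact: sub_mem0. Qed.
Lemma sub_memD u v : P u -> P v -> P (u + v).
Proof. by move=> hu hv; rewrite -[u]scale1r; apply: sub_memP. Qed.
Lemma sub_memN v : P v -> P (- v).
Proof. by rewrite -scaleN1r; exact: sub_memZ. Qed.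
Lemma sub_memB u v : P u -> P v -> P (u - v).
Proof. by move=> hu hv; apply: sub_memD => //; exact: sub_memN. Qed.

Definition sub_pred : {pred V} := fun v => `[< P v >].

Lemma sub_predE v : reflect (P v) (v \in sub_pred).
Proof. exact: asboolP. Qed.

Lemma sub_pred_closed : submod_closed sub_pred.
Proof.
split=> [|a u v /sub_predE hu /sub_predE hv]; apply/sub_predE.
  exact: sub_mem0.
exact: sub_memP.
Qed.
HB.instance Definition _ := GRing.isSubmodClosed.Build K V sub_pred sub_pred_closed.

Record subsp : Type := SubSp { subsp_val : V; _ : subsp_val \in sub_pred }.
HB.instance Definition _ := [isSub for subsp_val].
HB.instance Definition _ := [Choice of subsp by <:].
HB.instance Definition _ := [SubChoice_isSubLmodule of subsp by <:].

Lemma subsp_valP (x : subsp) : P (\val x).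
Proof. exact/sub_predE/(valP x). Qed.

Definition subsp_of v (hv : P v) : subsp := SubSp (introT (sub_predE v) hv).

Definition subincl : {linear subsp -> V} := \val.

Definition qequiv (u v : V) : bool := `[< P (u - v) >].
Lemma qequiv_equiv : equiv_class_of qequiv.
Proof.
split=> [u|u v|v u w].
- by apply/asboolP; rewrite subrr; exact: sub_mem0.
- by apply/asboolP/asboolP => /sub_memN; rewrite opprB.
- move=> /asboolP h1 /asboolP h2; apply/asboolP.
  by rewrite -(subrKA v); exact: sub_memD.
Qed.
Canonical qequiv_equiv_rel := EquivRelPack qequiv_equiv.

Definition quotsp := {eq_quot qequiv}.
HB.instance Definition _ : EqQuotient _ qequiv quotsp := EqQuotient.on quotsp.
HB.instance Definition _ := Choice.on quotsp.

Definition qpi (v : V) : quotsp := \pi_quotsp v.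

Lemma qpi_eq u v : qpi u = qpi v <-> P (u - v).
Proof. by split => [/eqmodP/asboolP|h] //; apply/eqmodP/asboolP. Qed.

Lemma qpi_repr (x : quotsp) : qpi (repr x) = x.
Proof. exact: reprK. Qed.

Lemma repr_qpi v : P (repr (qpi v) - v).
Proof. by apply/qpi_eq; rewrite qpi_repr. Qed.

Definition qadd (x y : quotsp) := qpi (repr x + repr y).
Definition qscale (a : K) (x : quotsp) := qpi (a *: repr x).
Definition qopp (x : quotsp) := qpi (- repr x).

Lemma qaddE u v : qadd (qpi u) (qpi v) = qpi (u + v).
Proof. by apply/qpi_eq; rewrite opprD addrACA; apply: sub_memD; exact: repr_qpi. Qed.
Lemma qoppE u : qopp (qpi u) = qpi (- u).
Proof. by apply/qpi_eq; rewrite -opprD; apply: sub_memN; exact: repr_qpi. Qed.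
Lemma qscaleE a u : qscale a (qpi u) = qpi (a *: u).
Proof. by apply/qpi_eq; rewrite -scalerBr; apply: sub_memZ; exact: repr_qpi. Qed.

Lemma qaddA : associative qadd.
Proof.
by move=> x y z; rewrite -[x]qpi_repr -[y]qpi_repr -[z]qpi_repr !qaddE addrA.
Qed.
Lemma qaddC : commutative qadd.
Proof. by move=> x y; rewrite -[x]qpi_repr -[y]qpi_repr !qaddE addrC. Qed.
Lemma qadd0 : left_id (qpi 0) qadd.
Proof. by move=> x; rewrite -[x]qpi_repr qaddE add0r. Qed.
Lemma qaddN : left_inverse (qpi 0) qopp qadd.
Proof. by move=> x; rewrite -[x]qpi_repr qoppE qaddE addNr. Qed.
HB.instance Definition _ := GRing.isZmodule.Build quotsp qaddA qaddC qadd0 qaddN.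

Lemma qpiD u v : qpi (u + v) = qpi u + qpi v.
Proof. by rewrite -qaddE. Qed.

Lemma qscaleA a b x : qscale a (qscale b x) = qscale (a * b) x.
Proof. by rewrite -[x]qpi_repr !qscaleE scalerA. Qed.
Lemma qscale1 : left_id 1 qscale.
Proof. by move=> x; rewrite -[x]qpi_repr !qscaleE scale1r. Qed.
Lemma qscaleDr : right_distributive qscale +%R.
Proof.
move=> a x y; rewrite -[x]qpi_repr -[y]qpi_repr -qpiD !qscaleE.
by rewrite scalerDr qpiD.
Qed.
Lemma qscaleDl x : {morph qscale^~ x : a b / a + b}.
Proof. by move=> a b; rewrite -[x]qpi_repr !qscaleE scalerDl qpiD. Qed.
HB.instance Definition _ := GRing.Zmodule_isLmodule.Build K quotsp
  qscaleA qscale1 qscaleDr qscaleDl.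

Lemma qpi_is_linear : linear qpi.
Proof. by move=> a u v; rewrite qpiD -qscaleE. Qed.
HB.instance Definition _ := GRing.isLinear.Build K V quotsp _ qpi qpi_is_linear.

Lemma qpi_eq0 v : qpi v = 0 <-> P v.
Proof. by rewrite -[v in P v]subr0; exact: qpi_eq. Qed.

Section QLift.
Variables (U : lmodType K) (f : {linear V -> U}).
Hypothesis f0 : forall v, P v -> f v = 0.
Definition qlift_fun (x : quotsp) : U := f (repr x).
Lemma qlift_funE v : qlift_fun (qpi v) = f v.
Proof. by apply/eqP; rewrite -subr_eq0 -linearB f0 //; exact: repr_qpi. Qed.
Lemma qlift_is_linear : linear qlift_fun.
Proof.
move=> a x y; rewrite -[x]qpi_repr -[y]qpi_repr -linearP.
by rewrite !qlift_funE linearP.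
Qed.
HB.instance Definition _ :=
  GRing.isLinear.Build K quotsp U _ qlift_fun qlift_is_linear.
Definition qlift : {linear quotsp -> U} := qlift_fun.
Lemma qliftE v : qlift (qpi v) = f v.
Proof. exact: qlift_funE. Qed.
End QLift.

Lemma complement_exists : exists A : subspace,
  (forall v, A v -> P v -> v = 0) /\ (forall m, exists2 w, A w & P (m - w)).
Proof.
pose good (A : set V) :=
  (forall a u v, A u -> A v -> A (a *: u + v)) /\ (forall v, A v -> P v -> v = 0).
have [F FP Ftot|A [[Acl Adis] Amax]] := @Zorn_bigcup V good.
  split=> [a u v [X FX Xu] [Y FY Yv]|v [X FX Xv]]; last exact: (FP X FX).2.
  have [XY|YX] := Ftot X Y FX FY.
    by exists Y => //; apply: (FP Y FY).1 => //; exact: XY.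
  by exists X => //; apply: (FP X FX).1 => //; exact: YX.
pose A0 (v : V) := v = 0 \/ A v.
have A0cl a u v : A0 u -> A0 v -> A0 (a *: u + v).
  move=> [->|hu] [->|hv]; rewrite ?scaler0 ?addr0 ?add0r; [by left|by right| |].
    right; have := Acl (a - 1) u u hu hu.
    by rewrite scalerBl scale1r subrK.
  by right; exact: Acl.
exists (@Subspace A0 (or_introl erefl) A0cl); split=> [v [->//|]|m].
  exact: Adis.
apply: contrapT => hm.
pose B (v : V) := exists a w, A0 w /\ v = a *: m + w.
have A0m w : A0 w -> P (m - w) -> False by move=> h1 h2; exact: (hm (ex_intro2 _ _ w h1 h2)).
case: (Amax B); last first.
  split=> [a _ _ [b [w [hw ->]]] [c [w' [hw' ->]]]|v [a [w [hw ->]]]].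
    exists (a * b + c), (a *: w + w'); split; first exact (A0cl _ _ _ hw hw').
    by rewrite scalerDr scalerA addrACA -scalerDl.
  have [->|a0] := eqVneq a 0.
    by rewrite scale0r add0r; case: hw => [//|]; exact: Adis.
  move=> h; exfalso; apply: (A0m (- (a^-1 *: w))).
    by rewrite -scaleNr -[_ *: _]addr0; apply (A0cl _ _ _ hw (or_introl erefl)).
  by have := sub_memZ a^-1 h; rewrite scalerDr scalerA mulVf // scale1r opprK.
split=> [v hv|BA]; first by exists 0, v; rewrite scale0r add0r; split=> //; right.
apply: (A0m m); last by rewrite subrr; exact: sub_mem0.
right; apply: BA; exists 1, 0; rewrite scale1r addr0; split=> //; by left.
Qed.

Lemma retract_exists : exists r : {linear V -> subsp}, forall x, r (\val x) = x.
Proof.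
have [A [Adis Acov]] := complement_exists.
have ex m : exists x : subsp, A (m - \val x).
  have [w hw hm] := Acov m; exists (subsp_of hm) => /=.
  by rewrite opprB addrC subrK.
have uniq m (x y : subsp) : A (m - \val x) -> A (m - \val y) -> x = y.
  move=> hx hy; apply: val_inj; apply/eqP; rewrite -subr_eq0; apply/eqP.
  apply: Adis; last by apply: sub_memB; exact: subsp_valP.
  have -> : \val x - \val y = (-1) *: (m - \val x) + (m - \val y).
    by rewrite scaleN1r opprB addrA subrK.
  exact: sub_memP.
pose r m := projT1 (cid (ex m)).
have rP m : A (m - \val (r m)) by rewrite /r; case: cid.
have r_lin : linear r.
  move=> a u v; apply: (uniq (a *: u + v)) => //.
  have -> : \val (a *: r u + r v) = a *: \val (r u) + \val (r v).
    exact: (linearP subincl).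
  by rewrite opprD addrACA -scalerBr; exact: sub_memP.
pose rl := GRing.isLinear.Build K V subsp _ r r_lin.
pose R : {linear V -> subsp} := HB.pack r rl.
exists R => x; apply: (uniq (\val x)); first exact: rP.
by rewrite subrr; exact: sub_mem0.
Qed.

End Subspaces.

Lemma linear_ext (K : fieldType) (V W : lmodType K) (f g : {linear V -> W}) :
  f =1 g -> f = g.
Proof.
case: f g => f [[a] [b]] [g [[c] [d]]] /= /funext fg; subst g.
by rewrite (Prop_irrelevance a c) (Prop_irrelevance b d).
Qed.

Section SubTensor.
Variables (K : fieldType) (V W : lmodType K).

Definition in_sub (P : subspace V) (t : V ⊗ W) :=
  exists u : subsp P ⊗ W, t = tmap (subincl P) idfun u.

Lemma in_subP (P : subspace V) (a : K) s t :
  in_sub P s -> in_sub P t -> in_sub P (a *: s + t).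
Proof. by move=> [u ->] [v ->]; exists (a *: u + v); rewrite linearP. Qed.

Lemma in_sub0 (P : subspace V) : in_sub P 0.
Proof. by exists 0; rewrite linear0. Qed.

Lemma in_subS (P Q : subspace V) t :
  (forall v, P v -> Q v) -> in_sub P t -> in_sub Q t.
Proof.
move=> PQ [u ->]; have [r rP] := retract_exists Q.
exists (tmap (r \o subincl P) idfun u); rewrite tmap_comp; apply: eq_tmap => // x /=.
by have /= := congr1 val (rP (subsp_of (PQ _ (subsp_valP x)))).
Qed.

End SubTensor.

Section Coalgebras.
Variable K : fieldType.

Record coalgebra := Coalgebra {
  coalg_sort :> lmodType K;
  comul : {linear coalg_sort -> coalg_sort ⊗ coalg_sort};
  counit : {linear coalg_sort -> K^o};
  comulA : forall c,
    tassoc _ _ _ (tmap comul idfun (comul c)) = tmap idfun comul (comul c);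
  counitl : forall c, tcontl _ counit (comul c) = c;
  counitr : forall c, tcontr _ counit (comul c) = c
}.

Record comodule (C : coalgebra) := Comodule {
  comod_sort :> lmodType K;
  coact : {linear comod_sort -> comod_sort ⊗ C};
  coactA : forall m,
    tassoc _ _ _ (tmap coact idfun (coact m)) = tmap idfun (comul C) (coact m);
  coact1 : forall m, tcontr _ (counit C) (coact m) = m
}.

Definition regular (C : coalgebra) : comodule C :=
  @Comodule C C (comul C) (@comulA C) (@counitr C).

Section Comodules.
Variable C : coalgebra.
Implicit Types M N : comodule C.

Record chom M N := CHom {
  chom_fun :> {linear M -> N};
  chom_coact : forall m, coact N (chom_fun m) = tmap chom_fun idfun (coact M m)
}.

Lemma chom_ext M N (f g : chom M N) : f =1 g -> f = g.
Proof.
case: f g => f hf [g hg] /= /linear_ext fg; subst g.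
by rewrite (Prop_irrelevance hf hg).
Qed.

Lemma cid_coact M (m : M) :
  coact M (idfun m) = tmap (idfun : {linear M -> M}) idfun (coact M m).
Proof. by rewrite tmap_id. Qed.
Definition cidmap M : chom M M := CHom (@cid_coact M).

Lemma ccomp_coact M N P (g : chom N P) (f : chom M N) m :
  coact P ((g \o f) m) = tmap (g \o f) idfun (coact M m).
Proof. by rewrite /= !chom_coact tmap_comp; apply: eq_tmap. Qed.
Definition ccomp M N P (g : chom N P) (f : chom M N) : chom M P :=
  CHom (ccomp_coact g f).

Definition cisom M N := exists (f : chom M N) (g : chom N M),
  cancel f g /\ cancel g f.

Record subcomodule M := Subcomodule {
  subc_sub :> subspace M;
  subc_coact : forall m, subc_sub m -> in_sub subc_sub (coact M m)
}.

Section SubObject.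
Variables (M : comodule C) (N : subcomodule M).

Definition subc_retract : {linear M -> subsp N} :=
  projT1 (cid (retract_exists N)).
Lemma subc_retractK (x : subsp N) : subc_retract (\val x) = x.
Proof. by rewrite /subc_retract; case: cid. Qed.

Definition subcom_coact : {linear subsp N -> subsp N ⊗ C} :=
  tmap subc_retract idfun \o coact M \o subincl N.

Lemma subcom_coactE x :
  tmap (subincl N) idfun (subcom_coact x) = coact M (\val x).
Proof.
have [t ht] := subc_coact (subsp_valP x); rewrite /subcom_coact /= ht.
by rewrite !tmap_comp; apply: eq_tmap => // y /=; rewrite subc_retractK.
Qed.

Lemma tmap_incl_inj (W : lmodType K) : injective (tmap (subincl N) (idfun : {linear W -> W})).
Proof.
apply: (can_inj (g := tmap subc_retract idfun)) => t.
by rewrite tmap_comp tmap_id // => y /=; rewrite subc_retractK.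
Qed.

Lemma subcom_coactA x :
  tassoc _ _ _ (tmap subcom_coact idfun (subcom_coact x)) =
  tmap idfun (comul C) (subcom_coact x).
Proof.
apply: tmap_incl_inj.
transitivity (tmap (subincl N) (tmap idfun idfun)
    (tassoc _ _ _ (tmap subcom_coact idfun (subcom_coact x)))).
  by apply: eq_tmap => // t; rewrite tmap_id.
rewrite -tassoc_nat tmap_comp.
transitivity (tassoc _ _ _ (tmap (coact M) idfun
    (tmap (subincl N) idfun (subcom_coact x)))).
  by rewrite tmap_comp; congr (tassoc _ _ _ _);
     apply: eq_tmap => // y; exact: subcom_coactE.
rewrite subcom_coactE coactA -subcom_coactE !tmap_comp.
exact: eq_tmap.
Qed.

Lemma subcom_coact1 x : tcontr _ (counit C) (subcom_coact x) = x.
Proof.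
apply: val_inj; rewrite -[RHS](coact1 (\val x)) -subcom_coactE tcontr_tmap /=.
by congr (\val _); apply: eq_tcontr.
Qed.

Definition subcom : comodule C := Comodule subcom_coactA subcom_coact1.

End SubObject.

Section Quotient.
Variables (M : comodule C) (N : subcomodule M).

Let quot_pre : {linear M -> quotsp N ⊗ C} :=
  tmap (@qpi K M N) idfun \o coact M.

Lemma quot_pre0 m : N m -> quot_pre m = 0.
Proof.
move=> /subc_coact[t ht]; rewrite /= ht tmap_comp.
move: t {ht}; apply: (tensor_ext (g := \0)) => x c /=; rewrite tmapE /=.
by rewrite (_ : qpi _ _ = 0) ?linear0l //; apply/qpi_eq0; exact: subsp_valP.
Qed.

Definition quotcom_coact : {linear quotsp N -> quotsp N ⊗ C} := qlift quot_pre0.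

Lemma quotcom_coactE m :
  quotcom_coact (qpi N m) = tmap (@qpi K M N) idfun (coact M m).
Proof. exact: qliftE. Qed.

Lemma quotcom_coactA x :
  tassoc _ _ _ (tmap quotcom_coact idfun (quotcom_coact x)) =
  tmap idfun (comul C) (quotcom_coact x).
Proof.
rewrite -[x]qpi_repr quotcom_coactE tmap_comp.
transitivity (tassoc _ _ _ (tmap (tmap (@qpi K M N) idfun) idfun
    (tmap (coact M) idfun (coact M (repr x))))).
  rewrite tmap_comp; congr (tassoc _ _ _ _).
  by apply: eq_tmap => // y; exact: quotcom_coactE.
rewrite tassoc_nat coactA !tmap_comp.
by apply: eq_tmap => // y /=; rewrite tmap_id.
Qed.

Lemma quotcom_coact1 x : tcontr _ (counit C) (quotcom_coact x) = x.
Proof.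
rewrite -[x]qpi_repr quotcom_coactE tcontr_tmap.
by rewrite -[in RHS](coact1 (repr x)); congr (qpi _ _); apply: eq_tcontr.
Qed.

Definition quotcom : comodule C := Comodule quotcom_coactA quotcom_coact1.

Lemma in_sub_preim (Q : subspace (quotsp N)) (P : subspace M) t :
  (forall m, P m <-> Q (qpi N m)) ->
  in_sub Q (tmap (@qpi K M N) (idfun : {linear C -> C}) t) -> in_sub P t.
Proof.
move=> PQ [u hu]; have [r rK] := retract_exists P.
pose d : {linear M -> M} := idfun \- (subincl P \o r).
have dP m : P m -> d m = 0.
  by move=> hm; rewrite /= (rK (subsp_of hm)) subrr.
have d0 m : N m -> d m = 0.
  by move=> hm; apply: dP; apply/PQ; rewrite (_ : qpi N m = 0);
    [exact: sub_mem0|exact/qpi_eq0].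
have dt : tmap d (idfun : {linear C -> C}) t = 0.
  transitivity (tmap (qlift d0) (idfun : {linear C -> C}) (tmap (@qpi K M N) idfun t)).
    by rewrite tmap_comp; apply: eq_tmap => // m; rewrite -(qliftE d0).
  rewrite hu tmap_comp.
  have dQ y : Q y -> qlift d0 y = 0.
    by rewrite -[y]qpi_repr => hy; rewrite qliftE dP //; apply/PQ.
  move: u {hu}; apply: (tensor_ext (g := \0)) => x c; rewrite tmapE.
  transitivity ((0 : M) ⊗t (c : C)); last by rewrite linear0l.
  by congr (_ ⊗t _); exact: (dQ _ (subsp_valP x)).
exists (tmap r idfun t); rewrite tmap_comp.
transitivity (tmap (d \+ (subincl P \o r)) (idfun : {linear C -> C}) t).
  by rewrite tmap_id // => m /=; rewrite subrK.
by rewrite tmap_addl dt add0r; exact: eq_tmap.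
Qed.

End Quotient.
Definition simple M :=
  (exists m : M, m <> 0) /\
  forall N : subcomodule M, (forall m, N m -> m = 0) \/ (forall m, N m).

(* The socle is the sum of all simple subcomodules. *)
Section Socle.
Variable M : comodule C.

Definition soc_mem (m : M) := exists2 s : seq M,
  (forall x, x \in s -> exists2 N : subcomodule M, simple (subcom N) & N x) &
  m = \sum_(x <- s) x.

Lemma soc_mem0 : soc_mem 0.
Proof. by exists [::]; rewrite ?big_nil. Qed.

Lemma soc_memP (a : K) u v : soc_mem u -> soc_mem v -> soc_mem (a *: u + v).
Proof.
move=> [s hs ->] [t ht ->]; exists ([seq a *: x | x <- s] ++ t).
  move=> x; rewrite mem_cat => /orP[/mapP[y ys ->]|]; last exact: ht.
  by have [N sN Ny] := hs y ys; exists N => //; exact: sub_memZ.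
by rewrite big_cat big_map /= scaler_sumr.
Qed.

Definition soc_sub : subspace M := Subspace soc_mem0 soc_memP.

Lemma soc_coact m : soc_sub m -> in_sub soc_sub (coact M m).
Proof.
move=> [s hs ->]; elim: s hs => [|x s IHs] hs.
  by rewrite big_nil linear0; exact: in_sub0.
rewrite big_cons -[x]scale1r linearP; apply: in_subP; last first.
  by apply: IHs => y ys; apply: hs; rewrite inE ys orbT.
have [|N sN Nx] := hs x; first by rewrite inE eqxx.
apply: (in_subS _ (subc_coact Nx)) => y Ny.
exists [:: y]; last by rewrite big_seq1.
by move=> z; rewrite inE => /eqP ->; exists N.
Qed.

Definition soc : subcomodule M := Subcomodule soc_coact.

End Socle.

Section Loewy.
Variable M : comodule C.

Section Preimage.
Variables (N : subcomodule M) (Q : subcomodule (quotcom N)).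
Definition preim_mem (m : M) := Q (qpi N m).
Lemma preim_mem0 : preim_mem 0.
Proof. by rewrite /preim_mem linear0; exact: sub_mem0. Qed.
Lemma preim_memP (a : K) u v :
  preim_mem u -> preim_mem v -> preim_mem (a *: u + v).
Proof. by rewrite /preim_mem linearP; exact: sub_memP. Qed.
Definition preim_sub : subspace M := Subspace preim_mem0 preim_memP.
Lemma preim_coact m : preim_sub m -> in_sub preim_sub (coact M m).
Proof.
move=> hm; apply: (in_sub_preim (Q := Q)) => //.
by rewrite -quotcom_coactE; exact: (subc_coact hm).
Qed.
Definition preim : subcomodule M := Subcomodule preim_coact.
End Preimage.

(* [loewy n] is Soc^n M; only n >= 1 is meaningful. *)
Definition loewy (n : nat) : subcomodule M :=
  iter n.-1 (fun N : subcomodule M => preim (soc (quotcom N))) (soc M).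

End Loewy.

Record extension (N M : comodule C) := Extension {
  ext_mid : comodule C;
  ext_in : chom M ext_mid;
  ext_out : chom ext_mid N;
  ext_inj : injective ext_in;
  ext_surj : forall n, exists x, ext_out x = n;
  ext_exact : forall x, ext_out x = 0 <-> exists m, ext_in m = x
}.

Definition split_extension N M (X : extension N M) :=
  exists s : chom N (ext_mid X), forall n, ext_out X (s n) = n.

(* Yoneda's Ext^1(N, M), whose zero element is the class of split extensions. *)
Definition Ext1_neq0 N M := exists X : extension N M, ~ split_extension X.

Definition injective_comodule (E : comodule C) :=
  forall (A B : comodule C) (i : chom A B) (f : chom A E),
    injective i -> exists g : chom B E, forall a, g (i a) = f a.

Definition essential M E (j : chom M E) :=
  forall N : subcomodule E, (exists2 x, N x & x <> 0) ->
  exists2 m, N (j m) & j m <> 0.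

Definition injective_envelope M E :=
  injective_comodule E /\ exists j : chom M E, injective j /\ essential j.

Definition direct_sum M (N : subcomodule M) (J : eqType)
    (F : J -> subcomodule M) :=
  (forall m, N m <-> exists (s : seq J) (x : J -> M),
     (forall j, F j (x j)) /\ m = \sum_(j <- s) x j) /\
  (forall (s : seq J) (x : J -> M), uniq s -> (forall j, F j (x j)) ->
     \sum_(j <- s) x j = 0 -> forall j, j \in s -> x j = 0).

Definition complete_simples (I : Type) (S : I -> comodule C) :=
  [/\ forall x, simple (S x),
      forall x y, cisom (S x) (S y) -> x = y &
      forall M, simple M -> exists x, cisom M (S x)].

End Comodules.

Definition basic (C : coalgebra) :=
  exists (J : eqType) (F : J -> subcomodule (regular C)),
    [/\ forall j, simple (subcom (F j)),
        forall i j, cisom (subcom (F i)) (subcom (F j)) -> i = j &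
        direct_sum (soc (regular C)) F].

Section LinearImage.
Variables (V W : lmodType K) (f : {linear V -> W}).
Definition limage_mem (w : W) := exists v, w = f v.
Lemma limage_mem0 : limage_mem 0.
Proof. by exists 0; rewrite linear0. Qed.
Lemma limage_memP (a : K) u v :
  limage_mem u -> limage_mem v -> limage_mem (a *: u + v).
Proof. by move=> [x ->] [y ->]; exists (a *: x + y); rewrite linearP. Qed.
Definition limage : subspace W := Subspace limage_mem0 limage_memP.
Definition lcores_fun (v : V) : subsp limage :=
  @subsp_of _ _ limage (f v) (ex_intro _ v erefl).
Lemma lcores_is_linear : linear lcores_fun.
Proof.
by move=> a u v; apply: val_inj; rewrite /= linearP.
Qed.
HB.instance Definition _ :=
  GRing.isLinear.Build K V (subsp limage) _ lcores_fun lcores_is_linear.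
Definition lcores : {linear V -> subsp limage} := lcores_fun.
Lemma lcoresE v : \val (lcores v) = f v.
Proof. by []. Qed.
End LinearImage.

Section Idempotents.
Variable C : coalgebra.

Definition mulK_fun (f g : {linear C -> K^o}) (c d : C) : K^o := f c * g d.
Lemma mulK_fun_bilinear f g : bilinear_for *:%R *:%R (mulK_fun f g).
Proof.
split=> [d|c] a x y; rewrite /mulK_fun /= linearP.
  by rewrite mulrDl -mulrA.
by rewrite mulrDr mulrCA.
Qed.
HB.instance Definition _ f g := bilinear_isBilinear.Build K C C K^o
  *:%R *:%R (mulK_fun f g) (mulK_fun_bilinear f g).

(* The convolution product of C^*: c |-> sum f(c_(1)) g(c_(2)). *)
Definition conv (f g : {linear C -> K^o}) (c : C) : K^o :=
  tlift (mulK_fun f g) (comul C c).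

Record conv_idempotent := ConvIdempotent {
  idem_fun :> {linear C -> K^o};
  idem_conv : forall c, conv idem_fun idem_fun c = idem_fun c
}.

Variable e : conv_idempotent.

(* [eact M m] is em, [lact c] is ec, [ract c] is ce and [lract c] is ece. *)
Definition eact (M : comodule C) : {linear M -> M} := tcontr M e \o coact M.
Definition lact : {linear C -> C} := tcontr C e \o comul C.
Definition ract : {linear C -> C} := tcontl C e \o comul C.
Definition lract : {linear C -> C} := ract \o lact.

Lemma coact_eact M m : coact M (eact M m) = tmap idfun lact (coact M m).
Proof.
transitivity (tcontr _ e (tmap (coact M) idfun (coact M m))).
  by rewrite tcontr_tmap; congr (coact M _); apply: eq_tcontr.
by rewrite tcontr_assoc coactA tmap_comp; exact: eq_tmap.
Qed.

Lemma comul_lact c : comul C (lact c) = tmap idfun lact (comul C c).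
Proof. exact: (@coact_eact (regular C)). Qed.

Lemma comul_ract c : comul C (ract c) = tmap ract idfun (comul C c).
Proof.
transitivity (tcontl _ e (tmap idfun (comul C) (comul C c))).
  by rewrite tcontl_tmap; congr (comul C _); apply: eq_tcontl.
by rewrite -comulA tcontl_assoc tmap_comp; exact: eq_tmap.
Qed.

Lemma idem_lact c : e (lact c) = e c.
Proof.
rewrite -[RHS]idem_conv /lact /= /conv; move: (comul C c).
apply: (tensor_ext (f := e \o tcontr C e) (g := tlift (mulK_fun e e))) => u v.
rewrite [RHS]tlift_tens /= tcontrE linearZ /=; exact: mulrC.
Qed.

Lemma idem_ract c : e (ract c) = e c.
Proof.
rewrite -[RHS]idem_conv /ract /= /conv; move: (comul C c).
apply: (tensor_ext (f := e \o tcontl C e) (g := tlift (mulK_fun e e))) => u v.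
by rewrite [RHS]tlift_tens /= tcontlE linearZ.
Qed.

Lemma eact_idem M m : eact M (eact M m) = eact M m.
Proof.
rewrite {1}/eact /= coact_eact tcontr_tmap /=.
by apply: eq_tcontr => c; exact: idem_lact.
Qed.

Lemma lact_idem c : lact (lact c) = lact c.
Proof. exact: (@eact_idem (regular C)). Qed.

Lemma ract_idem c : ract (ract c) = ract c.
Proof.
rewrite {1}/ract /= comul_ract tcontl_tmap /=.
by apply: eq_tcontl => d; exact: idem_ract.
Qed.

Lemma lact_ract c : lact (ract c) = ract (lact c).
Proof.
by rewrite {1}/lact /= comul_ract tcontr_tmap.
Qed.

Lemma lract_lact c : lract (lact c) = lract c.
Proof. exact: (congr1 ract (lact_idem c)). Qed.

Lemma lract_ract c : lract (ract c) = lract c.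
Proof. exact: (etrans (congr1 ract (lact_ract c)) (ract_idem (lact c))). Qed.

Lemma counit_lact c : counit C (lact c) = e c.
Proof.
rewrite -{2}[c]counitl /lact /=; move: (comul C c).
apply: (tensor_ext (f := counit C \o tcontr C e) (g := e \o tcontl C (counit C))).
move=> u v; rewrite /= tcontrE tcontlE !linearZ /=; exact: mulrC.
Qed.

Lemma counit_ract c : counit C (ract c) = e c.
Proof.
rewrite -{2}[c]counitr /ract /=; move: (comul C c).
apply: (tensor_ext (f := counit C \o tcontl C e) (g := e \o tcontr C (counit C))).
move=> u v; rewrite /= tcontrE tcontlE !linearZ /=; exact: mulrC.
Qed.

Lemma counit_lract c : counit C (lract c) = e c.
Proof. exact: (etrans (counit_ract (lact c)) (idem_lact c)). Qed.

Definition corner_sort : lmodType K := subsp (limage lract).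

Local Notation q := (lcores lract).

Lemma q_lact c : q (lact c) = q c.
Proof. by apply: val_inj; exact: lract_lact. Qed.
Lemma q_ract c : q (ract c) = q c.
Proof. by apply: val_inj; exact: lract_ract. Qed.

Lemma val_corner (x : corner_sort) : lract (\val x) = \val x.
Proof.
have [c ->] := subsp_valP x.
exact: (etrans (lract_ract (lact c)) (lract_lact c)).
Qed.

(* Delta(ece) = sum e c_(1) e (x) e c_(2) e; the right-hand side depends only
   on ece, so that it may be computed from c := ece. *)
Definition corner_comul : {linear corner_sort -> corner_sort ⊗ corner_sort} :=
  tmap q q \o comul C \o subincl (limage lract).

Lemma corner_comulE c :
  corner_comul (q c) = tmap q q (comul C c).
Proof.
rewrite /corner_comul /= comul_ract comul_lact !tmap_comp.
by apply: eq_tmap => d /=; [exact: q_ract|exact: q_lact].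
Qed.

Definition corner_counit : {linear corner_sort -> K^o} :=
  counit C \o subincl (limage lract).

Lemma corner_comulA x :
  tassoc _ _ _ (tmap corner_comul idfun (corner_comul x)) =
  tmap idfun corner_comul (corner_comul x).
Proof.
rewrite {2 4}/corner_comul /=; set c := subsp_val x.
rewrite !tmap_comp.
transitivity (tassoc _ _ _ (tmap (tmap q q) q (tmap (comul C) idfun (comul C c)))).
  rewrite tmap_comp; congr (tassoc _ _ _ _); apply: eq_tmap => // d.
  exact: corner_comulE.
rewrite tassoc_nat comulA tmap_comp; apply: eq_tmap => // d.
exact: (esym (corner_comulE d)).
Qed.

Lemma corner_counitl x : tcontl _ corner_counit (corner_comul x) = x.
Proof.
rewrite /corner_comul /= tcontl_tmap; apply: val_inj; rewrite lcoresE.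
rewrite -[RHS]val_corner -[in RHS]lract_ract.
congr (lract _); apply: eq_tcontl => d; exact: counit_lract.
Qed.

Lemma corner_counitr x : tcontr _ corner_counit (corner_comul x) = x.
Proof.
rewrite /corner_comul /= tcontr_tmap; apply: val_inj; rewrite lcoresE.
rewrite -[RHS]val_corner -[in RHS]lract_lact.
congr (lract _); apply: eq_tcontr => d; exact: counit_lract.
Qed.

Definition corner : coalgebra :=
  Coalgebra corner_comulA corner_counitl corner_counitr.

Section QuotientFunctor.
Variable M : comodule C.

Definition Tsort : lmodType K := subsp (limage (eact M)).
Local Notation p := (lcores (eact M)).

Lemma val_T (x : Tsort) : eact M (\val x) = \val x.
Proof. by have [m ->] := subsp_valP x; rewrite eact_idem. Qed.

(* em |-> sum e m_(0) (x) e m_(1) e *)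
Definition Tcoact : {linear Tsort -> Tsort ⊗ corner_sort} :=
  tmap p q \o coact M \o subincl (limage (eact M)).

Lemma TcoactE m : Tcoact (p m) = tmap p q (coact M m).
Proof.
rewrite /Tcoact /= coact_eact tmap_comp.
by apply: eq_tmap => d //=; exact: q_lact.
Qed.

Lemma TcoactA x :
  tassoc _ _ _ (tmap Tcoact idfun (Tcoact x)) =
  tmap idfun (comul corner) (Tcoact x).
Proof.
rewrite {2 3}/Tcoact /=; set m := subsp_val x.
rewrite !tmap_comp.
transitivity (tassoc _ _ _ (tmap (tmap p q) q (tmap (coact M) idfun (coact M m)))).
  rewrite tmap_comp; congr (tassoc _ _ _ _); apply: eq_tmap => // d.
  exact: TcoactE.
rewrite tassoc_nat coactA tmap_comp; apply: eq_tmap => // d.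
exact: (esym (corner_comulE d)).
Qed.

Lemma Tcoact1 x : tcontr _ (counit corner) (Tcoact x) = x.
Proof.
rewrite /Tcoact /= tcontr_tmap; apply: val_inj; rewrite lcoresE.
transitivity (eact M (eact M (\val x))); last by rewrite eact_idem val_T.
congr (eact M _); apply: eq_tcontr => d; exact: counit_lract.
Qed.

Definition Tfun : comodule corner := @Comodule corner Tsort Tcoact TcoactA Tcoact1.

End QuotientFunctor.

Section QuotientFunctorMap.
Variables (M N : comodule C) (f : chom M N).

Lemma chom_eact m : f (eact M m) = eact N (f m).
Proof.
rewrite /eact /= chom_coact tcontr_tmap; congr (f _); exact: eq_tcontr.
Qed.

Lemma Tmap_subproof (x : Tfun M) : limage (eact N) (f (\val x)).
Proof. by have [m ->] := subsp_valP x; exists (f m); exact: chom_eact. Qed.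

Definition Tmap_fun (x : Tfun M) : Tfun N := subsp_of (Tmap_subproof x).
Lemma Tmap_is_linear : linear Tmap_fun.
Proof. by move=> a x y; apply: val_inj; rewrite /= !linearP. Qed.
HB.instance Definition _ :=
  GRing.isLinear.Build K (Tfun M) (Tfun N) _ Tmap_fun Tmap_is_linear.

Lemma Tmap_coact x :
  coact (Tfun N) (Tmap_fun x) = tmap Tmap_fun idfun (coact (Tfun M) x).
Proof.
rewrite /= /Tcoact /= chom_coact !tmap_comp.
by apply: eq_tmap => // m; apply: val_inj; exact: (esym (chom_eact m)).
Qed.

Definition Tmap : chom (Tfun M) (Tfun N) := CHom Tmap_coact.

End QuotientFunctorMap.

(* M lies in the localizing subcategory of e, i.e. T(M) = 0. *)
Definition torsion (M : comodule C) := forall z : Tfun M, z = 0.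

Definition stable := forall M E : comodule C,
  injective_envelope M E -> torsion M -> torsion E.

(* T(M) = M, as an equality between the subspace eM of M and M. *)
Definition T_fixes (M : comodule C) := forall m : M, limage (eact M) m.

(* eC = eCe *)
Definition left_semicentral := forall c : C, limage lact c <-> limage lract c.

Record left_adjoint := LeftAdjoint {
  ladj :> comodule corner -> comodule C;
  ladj_map : forall N N', chom N N' -> chom (ladj N) (ladj N');
  ladj_id : forall N, ladj_map (cidmap N) = cidmap (ladj N);
  ladj_comp : forall N N' N'' (g : chom N' N'') (f : chom N N'),
    ladj_map (ccomp g f) = ccomp (ladj_map g) (ladj_map f);
  ladj_hom : forall N M, chom (ladj N) M -> chom N (Tfun M);
  ladj_hom_bij : forall N M, bijective (@ladj_hom N M);
  ladj_natl : forall N N' M (f : chom N N') (g : chom (ladj N') M),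
    ladj_hom (ccomp g (ladj_map f)) = ccomp (ladj_hom g) f;
  ladj_natr : forall N M M' (h : chom M M') (g : chom (ladj N) M),
    ladj_hom (ccomp h g) = ccomp (Tmap h) (ladj_hom g)
}.

End Idempotents.

Section ExtQuiver.
Variables (C : coalgebra) (I : Type) (S E : I -> comodule C).

Definition arrow (y x : I) := Ext1_neq0 (S y) (S x).

Definition connected_quiver := forall x y, clos_refl_sym_trans I arrow x y.

Definition path_in_quiver := clos_refl_trans I arrow.

Definition right_link_closed (L : I -> Prop) :=
  forall x y, arrow x y -> L x -> L y.

Definition n_predecessor (n : nat) (y x : I) :=
  Ext1_neq0 (S y) (subcom (loewy (E x) n)).

Definition predecessor (y x : I) :=
  exists n : nat, (0 < n)%N /\ n_predecessor n y x.

End ExtQuiver.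
End Coalgebras.

(* Main.v *)
(* A right C-comodule is a rational module over the convolution algebra C^*:
   subcomodules and comodule maps are the subspaces stable under, and the linear
   maps commuting with, all operators m |-> sum m_(0) f(m_(1)).  Every condition
   is compared with the statement that eM is a subcomodule of M for every M,
   which is the module form of eC = eCe.
   Since C is basic, e acts on each simple comodule as 0 or as the identity.  If
   n = f(em) - e(f(em)) <> 0, a simple quotient of the subcomodule generated by n
   is torsion, so n survives in a map M -> E_y with y torsion; if all these E_y
   are torsion, that map kills em, a contradiction.
   If some E_y with y torsion is not torsion, a cyclic subcomodule of E_y
   generated by some m = em, of least dimension, has a simple torsion-free
   quotient with nonzero torsion kernel, and a quotient of it is a nonsplit
   extension, that is, an arrow from a torsion-free vertex to a torsion one.
   When eC = eCe, every corner comodule is itself a C-comodule and this is left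
   adjoint to T, hence T preserves injective envelopes and H(T(S_x)) = S_x.
   Conversely, if H(T(S_x)) = S_x, an extension of S_x by a torsion comodule is
   split by the adjoint of the inverse of T applied to its projection. *)
Require Import Defs.
From HB Require Import structures.
From mathcomp Require Import all_boot all_order all_algebra.
From mathcomp Require Import boolp classical_sets.

Set Implicit Arguments.
Unset Strict Implicit.
Unset Printing Implicit Defensive.

Import GRing.Theory.
Local Open Scope ring_scope.

(** * Linear algebra in arbitrary dimension: functionals, spanning lists, contractions of tensors *)

Section LinearAlgebra.
Variable K : fieldType.
Implicit Types V W : lmodType K.

Lemma linear_pack V W (f : V -> W) : linear f -> {g : {linear V -> W} | g =1 f}.
Proof.
move=> hf; pose m := GRing.isLinear.Build K V W _ f hf.
pose g : {linear V -> W} := HB.pack f m.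
by exists g.
Qed.

(** A retraction onto Kv + P is followed by the coefficient of [v], which is well defined because
    [v] lies outside [P]. *)
Lemma functional_outside V (P : subspace V) (v : V) : ~ P v ->
  exists f : {linear V -> K^o}, f v = 1 /\ forall x, P x -> f x = 0.
Proof.
move=> nPv.
pose L (x : V) := exists a : K, exists2 p, P p & x = a *: v + p.
have L0 : L 0 by exists 0, 0; [exact: sub_mem0 | rewrite scale0r addr0].
have LP (a : K) x y : L x -> L y -> L (a *: x + y).
  move=> [b [p hp ->]] [c [q hq ->]]; exists (a * b + c), (a *: p + q).
    exact: sub_memP.
  by rewrite scalerDr scalerA scalerDl addrACA.
pose LS := Subspace L0 LP; have [r rK] := retract_exists LS.
have exa x : exists a : K, P (\val (r x) - a *: v).
  by have [a [p hp ->]] := subsp_valP (r x); exists a; rewrite addrC addKr.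
have uniq_coef x a b : P (x - a *: v) -> P (x - b *: v) -> a = b.
  move=> ha hb; apply/eqP; rewrite -subr_eq0; case: eqVneq => // nz; exfalso.
  apply: nPv; have := sub_memZ (a - b)^-1 (sub_memB hb ha).
  have -> : x - b *: v - (x - a *: v) = (a - b) *: v.
  by rewrite opprB [LHS]addrC addrA subrK scalerBl.
by rewrite scalerA mulVf ?scale1r.
pose f x : K^o := projT1 (cid (exa x)).
have fP x : P (\val (r x) - f x *: v) by rewrite /f; case: cid.
have f_lin : linear f.
  move=> a x y; apply: (uniq_coef (\val (r (a *: x + y)))) => //.
  have -> : \val (r (a *: x + y)) = a *: \val (r x) + \val (r y).
    by rewrite linearP; exact: (linearP (subincl _)).
  rewrite scalerDl -scalerA opprD addrACA -scalerBr; exact: sub_memP.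
have [g gE] := linear_pack f_lin; exists g; split=> [|x Px]; rewrite gE.
  have Lv : LS v by exists 1, 0; [exact: sub_mem0 | rewrite scale1r addr0].
  apply: (uniq_coef v); last by rewrite scale1r subrr; exact: sub_mem0.
  by have := fP v; rewrite (rK (subsp_of Lv)).
have Lx : LS x by exists 0, x; rewrite ?scale0r ?add0r.
apply: (uniq_coef x); last by rewrite scale0r subr0.
by have := fP x; rewrite (rK (subsp_of Lx)).
Qed.

Lemma zero_subspaceP V (a : K) (u v : V) : u = 0 -> v = 0 -> a *: u + v = 0.
Proof. by move=> -> ->; rewrite scaler0 addr0. Qed.
Definition zero_subspace V : subspace V :=
  @Subspace _ _ (fun v => v = 0) erefl (@zero_subspaceP V).

Lemma functional_neq0 V (v : V) : v <> 0 -> exists f : {linear V -> K^o}, f v = 1.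
Proof. by move=> /(functional_outside (P := zero_subspace V))[f [f1 _]]; exists f. Qed.

Lemma functional_ext V (u v : V) :
  (forall f : {linear V -> K^o}, f u = f v) -> u = v.
Proof.
move=> h; apply: contrapT => uv; have [|f] := @functional_neq0 _ (u - v).
  by move/eqP; rewrite subr_eq0 => /eqP.
by rewrite linearB /= h subrr => /esym/eqP; rewrite oner_eq0.
Qed.

(* [sp P s] is the span of [s] modulo [P]. *)
Fixpoint sp V (P : subspace V) (s : seq V) (x : V) : Prop :=
  if s is v :: s' then exists a : K, sp P s' (x - a *: v) else P x.

Lemma sp0 V (P : subspace V) s : sp P s 0.
Proof.
elim: s => [|v s ih] /=; first exact: sub_mem0.
by exists 0; rewrite scale0r subr0.
Qed.

Lemma spP V (P : subspace V) s (a : K) x y :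
  sp P s x -> sp P s y -> sp P s (a *: x + y).
Proof.
elim: s x y => [|v s ih] x y /=; first exact: sub_memP.
move=> [b hb] [c hc]; exists (a * b + c).
by rewrite scalerDl -scalerA opprD addrACA -scalerBr; exact: ih.
Qed.

Definition span_sub V (P : subspace V) s : subspace V :=
  Subspace (sp0 P s) (@spP V P s).

Lemma sp_mem V (P : subspace V) s x : x \in s -> sp P s x.
Proof.
elim: s => [|v s ih] //=; rewrite inE => /orP[/eqP ->|/ih h].
  by exists 1; rewrite scale1r subrr; exact: sp0.
by exists 0; rewrite scale0r subr0.
Qed.

Lemma sp_least V (P Q : subspace V) s : (forall x, P x -> Q x) ->
  (forall x, x \in s -> Q x) -> forall x, sp P s x -> Q x.
Proof.
move=> PQ; elim: s => [|v s ih] hs x /=; first exact: PQ.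
move=> [a ha]; rewrite -(subrK (a *: v) x) addrC.
apply: sub_memP; first by apply: hs; rewrite inE eqxx.
by apply: ih => // y ys; apply: hs; rewrite inE ys orbT.
Qed.

(** Steinitz exchange: the first generator occurring in [x] with nonzero coefficient is replaced by
    [x]. Lengths of spanning lists stand in for dimensions below. *)
Lemma sp_exchange V (P : subspace V) s x : sp P s x -> ~ P x ->
  exists2 s', size s = (size s').+1 & forall z, sp P s z -> sp P (x :: s') z.
Proof.
elim: s x => [|v s ih] x //= [a ha] nPx.
have [a0|a0] := eqVneq a 0.
  rewrite a0 scale0r subr0 in ha.
  have [s' hs hz] := ih _ ha nPx; exists (v :: s') => [|z [b hb]].
    by rewrite /= hs.
  have [c hc] := hz _ hb; exists c, b.
  by rewrite addrAC.
exists s => // z [b hb]; exists (b / a).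
have -> : z - (b / a) *: x = - (b / a) *: (x - a *: v) + (z - b *: v).
  rewrite scalerBr scaleNr scalerA mulNr divfK // scaleNr opprK.
  by rewrite -addrA [b *: v + _]addrC subrK addrC.
exact: spP.
Qed.

Lemma sp_map V W (f : {linear V -> W}) (P : subspace V) (Q : subspace W) s x :
  (forall x, P x -> Q (f x)) -> sp P s x -> sp Q (map f s) (f x).
Proof.
move=> PQ; elim: s x => [|v s ih] x /=; first exact: PQ.
by move=> [a /ih h]; exists a; rewrite -linearZ -linearB.
Qed.

(** The projection [p] onto [A] kills [y - p y], which is nonzero since [y] is outside [A]. Exchange
    this vector for a generator and apply [p] to the remaining ones: they span [A], and there is one
    fewer. *)
Lemma sp_proper V (A : subspace V) s y :
  (forall x, A x -> sp (zero_subspace V) s x) ->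
  sp (zero_subspace V) s y -> ~ A y ->
  exists s', [/\ size s = (size s').+1, forall x, x \in s' -> A x &
    forall x, A x -> sp (zero_subspace V) s' x].
Proof.
move=> As sy nAy; have [r rK] := retract_exists A.
pose p : {linear V -> V} := subincl A \o r.
have pE x : A x -> p x = x by move=> hx; rewrite /= (rK (subsp_of hx)).
have pA x : A (p x) by exact: subsp_valP.
have [||s' hs hz] := @sp_exchange V (zero_subspace V) s (y - p y).
- by rewrite -scaleN1r addrC; apply: spP => //; exact: As.
- by move=> /eqP; rewrite subr_eq0 => /eqP yp; apply: nAy; rewrite yp.
exists (map p s'); split=> [|x /mapP[z _ ->]|x Ax]; rewrite ?size_map //.
have [a ha] := hz _ (As _ Ax).
have pb : p (x - a *: (y - p y)) = x.
  have e0 : p (y - p y) = 0 by rewrite linearB [p (p y)]pE // subrr.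
  by rewrite linearB [p (_ *: _)]linearZ_LR e0 scaler0 subr0 pE.
rewrite -pb; apply: sp_map ha => z ->; exact: linear0.
Qed.

(** Either the span of [s] leaves [A] and [sp_proper] applies, or [s] already consists of vectors of
    [A]. *)
Lemma sp_generators V (A : subspace V) s :
  (forall x, A x -> sp (zero_subspace V) s x) ->
  exists s', [/\ (size s' <= size s)%N, forall x, x \in s' -> A x &
    forall x, A x -> sp (zero_subspace V) s' x].
Proof.
move=> As; case: (pselect (exists2 y, sp (zero_subspace V) s y & ~ A y)).
  move=> [y sy nAy]; have [s' [h1 h2 h3]] := sp_proper As sy nAy.
  by exists s'; split=> //; rewrite h1.
move=> h; exists s; split=> // x xs; apply: contrapT => nAx.
by apply: h; exists x => //; exact: sp_mem.
Qed.

(** Induction on the number of pure terms. If the first right factor depends on the others, its term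
    is absorbed into theirs; if not, a functional equal to 1 on it and to 0 on the others shows that
    its left factor is 0. *)
Lemma tensor_eq0 V W (t : V ⊗ W) :
  (forall f : {linear W -> K^o}, tcontr V f t = 0) -> t = 0.
Proof.
rewrite [t]tensor_sum; move: (repr t) => s {t}; move: {2}(size s) (leqnn (size s)) => n.
elim: n s => [|n ih] [|[v w] s] //; rewrite ?big_nil //= ltnS => hs.
have contrE (l : seq (V * W)) (f : {linear W -> K^o}) :
    tcontr V f (\sum_(p <- l) p.1 ⊗t p.2) = \sum_(p <- l) (f p.2 : K) *: p.1.
  by rewrite linear_sum; apply: eq_bigr => p _; exact: tcontrE.
case: (pselect (sp (zero_subspace W) (map snd s) w)) => [|nw] h.
  have [s' hs' e] : exists2 s' : seq (V * W), size s' = size s &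
      \sum_(p <- (v, w) :: s) p.1 ⊗t p.2 = \sum_(p <- s') p.1 ⊗t p.2.
    rewrite big_cons /=; elim: s w {hs ih} h => [|[v1 w1] s ih] w /=.
      by move=> ->; exists [::] => //; rewrite linear0r big_nil addr0.
    move=> [a /ih[s' hs' e]]; exists ((v1 + a *: v, w1) :: s'); first by rewrite /= hs'.
    rewrite !big_cons /= -e linearDl /= linearBr /= linearZr_LR linearZl_LR /=.
    by rewrite addrCA -addrA; congr (_ + _); rewrite addrCA addrA subrK.
  by rewrite e; apply: ih; rewrite ?hs' // => f; rewrite -e.
have [f [f1 f0]] := functional_outside (P := span_sub (zero_subspace W) (map snd s)) nw.
have v0 : v = 0.
  have := h f; rewrite contrE big_cons /= f1 scale1r big_seq big1 ?addr0 //.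
  move=> p ps; rewrite f0 ?scale0r //; apply: sp_mem; exact: map_f.
rewrite big_cons /= v0 linear0l add0r; apply: ih => // g.
by rewrite -(h g) !contrE big_cons /= v0 scaler0 add0r.
Qed.

Lemma tensor_contr_ext V W (s t : V ⊗ W) :
  (forall f : {linear W -> K^o}, tcontr V f s = tcontr V f t) -> s = t.
Proof.
move=> h; apply/eqP; rewrite -subr_eq0; apply/eqP/tensor_eq0 => f.
by rewrite linearB /= h subrr.
Qed.

(** This turns the coaction condition on subcomodules into stability under operators. A retraction
    onto [P] fixes every contraction of [t], hence fixes [t]. *)
Lemma in_sub_contr V W (P : subspace V) (t : V ⊗ W) :
  (forall f : {linear W -> K^o}, P (tcontr V f t)) -> in_sub P t.
Proof.
move=> h; have [r rK] := retract_exists P.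
exists (tmap r idfun t); apply: tensor_contr_ext => f.
rewrite tmap_comp tcontr_tmap /=.
rewrite (@eq_tcontr K V W (f \o idfun) f) //.
by rewrite (rK (subsp_of (h f))).
Qed.

Lemma contr_in_sub V W (P : subspace V) (t : V ⊗ W) (f : {linear W -> K^o}) :
  in_sub P t -> P (tcontr V f t).
Proof. by move=> [u ->]; rewrite tcontr_tmap; exact: subsp_valP. Qed.

End LinearAlgebra.

(** * Comodules as modules over the convolution algebra *)

Section Act.
Variables (K : fieldType) (C : coalgebra K).
Implicit Types (M N P : comodule C) (f g : {linear C -> K^o}).

(* The left action of the convolution algebra C^* on a right comodule,
   f m = sum m_(0) f(m_(1)). *)
Definition act M f : {linear M -> M} := tcontr M f \o coact M.

Definition lactf f : {linear C -> C} := tcontr C f \o comul C.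
Definition ractf f : {linear C -> C} := tcontl C f \o comul C.

Lemma actE M f m : act M f m = tcontr M f (coact M m).
Proof. by []. Qed.

Lemma eq_act M f g m : f =1 g -> act M f m = act M g m.
Proof. by move=> fg; exact: eq_tcontr. Qed.

Lemma act_counit M m : act M (counit C) m = m.
Proof. exact: coact1. Qed.

(** [g \o lactf f] is the convolution product of [g] and [f], so coassociativity of the coaction
    becomes associativity of the module action. *)
Lemma act_act M f g m : act M g (act M f m) = act M (g \o lactf f) m.
Proof.
transitivity (tcontr M g (tcontr _ f (tmap (coact M) idfun (coact M m)))).
  by rewrite tcontr_tmap /=; congr (tcontr M g (coact M _)); exact: eq_tcontr.
rewrite tcontr_assoc coactA tmap_comp tcontr_tmap /=.
exact: eq_tcontr.
Qed.

Lemma lactf_ractf f g c : g (lactf f c) = f (ractf g c).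
Proof.
rewrite /=; move: (comul C c).
apply: (tensor_ext (f := g \o tcontr C f) (g := f \o tcontl C g)) => u v.
by rewrite /= tcontrE tcontlE !linearZ /=; exact: mulrC.
Qed.

Lemma act_actr M f g m : act M g (act M f m) = act M (f \o ractf g) m.
Proof. by rewrite act_act; apply: eq_act => c; exact: lactf_ractf. Qed.

Lemma actD M (a : K) f g m :
  exists h : {linear C -> K^o}, act M h m = a *: act M f m + act M g m.
Proof.
exists ((a \*: f) \+ g); rewrite !actE; move: (coact M m).
apply: (tensor_ext (g := (a \*: tcontr M f) \+ tcontr M g)) => u v /=.
by rewrite !tcontrE /= scalerDl scalerA.
Qed.

Lemma chom_act M N (f : chom M N) g m : f (act M g m) = act N g (f m).
Proof.
by rewrite !actE chom_coact tcontr_tmap; congr (f _); exact: eq_tcontr.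
Qed.

(** Compatibility with the coaction is an equality of tensors, so it can be tested on contractions,
    where it reads as compatibility with the action. *)
Lemma chom_pack M N (f : M -> N) : linear f ->
  (forall g m, f (act M g m) = act N g (f m)) -> {h : chom M N | h =1 f}.
Proof.
move=> f_lin f_act; have [h hf] := linear_pack f_lin.
have hc m : coact N (h m) = tmap h idfun (coact M m).
  apply: tensor_contr_ext => g; rewrite tcontr_tmap hf.
  rewrite [LHS](esym (f_act g m)) -hf; congr (h _); exact: eq_tcontr.
by exists (CHom hc).
Qed.

Lemma subc_act M (N : subcomodule M) f m : N m -> N (act M f m).
Proof. by move=> /subc_coact; exact: contr_in_sub. Qed.

Lemma sub_act_coact M (P : subspace M) :
  (forall f m, P m -> P (act M f m)) ->
  forall m, P m -> in_sub P (coact M m).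
Proof. by move=> h m Pm; apply: in_sub_contr => f; exact: h. Qed.

Definition act_subcomodule M (P : subspace M)
  (hP : forall f m, P m -> P (act M f m)) : subcomodule M :=
  Subcomodule (sub_act_coact hP).

Lemma subcom_pack M (P : M -> Prop) : P 0 ->
  (forall (a : K) u v, P u -> P v -> P (a *: u + v)) ->
  (forall f m, P m -> P (act M f m)) ->
  {N : subcomodule M | forall m, N m <-> P m}.
Proof.
move=> h0 hp ha; pose Q := Subspace h0 hp.
by exists (act_subcomodule (P := Q) ha).
Qed.

Lemma cyc_sub0 M (m : M) : exists f, (0 : M) = act M f m.
Proof.
exists \0; rewrite actE; move: (coact M m).
by apply: (tensor_ext (f := \0)) => u v; rewrite tcontrE /= scale0r.
Qed.

Lemma cyc_subP M (m : M) (a : K) u v : (exists f, u = act M f m) ->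
  (exists f, v = act M f m) -> exists f, a *: u + v = act M f m.
Proof.
by move=> [f ->] [g ->]; have [h hh] := actD a f g m; exists h.
Qed.

Definition cyc_subspace M (m : M) := Subspace (cyc_sub0 m) (@cyc_subP M m).

Lemma cyc_act M (m : M) f x : cyc_subspace m x -> cyc_subspace m (act M f x).
Proof. by move=> [g ->]; rewrite act_act; exists (f \o lactf g). Qed.

Definition cyc M (m : M) : subcomodule M := act_subcomodule (@cyc_act M m).

Lemma cyc_mem M (m : M) : cyc m m.
Proof. by exists (counit C); rewrite act_counit. Qed.

Lemma cyc_min M (m : M) (N : subcomodule M) : N m -> forall x, cyc m x -> N x.
Proof. by move=> Nm x [f ->]; exact: subc_act. Qed.

(** Local finiteness of comodules: every f m is a combination of the finitely many left factors of
    [coact M m]. *)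
Lemma cyc_span M (m : M) :
  exists s, forall x, cyc m x -> sp (zero_subspace M) s x.
Proof.
exists (map fst (repr (coact M m))) => x [f ->].
rewrite actE [in tcontr _ _ _](tensor_sum (coact M m)).
elim: (repr (coact M m)) => [|p s ih]; first by rewrite big_nil linear0.
by rewrite big_cons linearD tcontrE /=; exists (f p.2); rewrite addrC addKr.
Qed.

Lemma subcom_act M (N : subcomodule M) f (x : subcom N) :
  \val (act (subcom N) f x) = act M f (\val x).
Proof.
rewrite (actE f (\val x)) -[coact M (\val x)](subcom_coactE (N := N)) tcontr_tmap.
by congr (\val _); apply: eq_tcontr.
Qed.

(** * Inclusions, projections, images, kernels and factorizations of comodule maps *)

Lemma subincl_coact M (N : subcomodule M) x :
  coact M (subincl N x) = tmap (subincl N) idfun (coact (subcom N) x).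
Proof. by rewrite subcom_coactE. Qed.
Definition cincl M (N : subcomodule M) : chom (subcom N) M :=
  @CHom K C (subcom N) M (subincl N) (@subincl_coact M N).

Lemma qpi_coact M (N : subcomodule M) m :
  coact (quotcom N) (qpi N m) = tmap (@qpi K M N) idfun (coact M m).
Proof. exact: quotcom_coactE. Qed.
Definition cproj M (N : subcomodule M) : chom M (quotcom N) :=
  @CHom K C M (quotcom N) (@qpi K M N) (@qpi_coact M N).

Lemma cproj_surj M (N : subcomodule M) y : exists m, cproj N m = y.
Proof. by exists (repr y); exact: qpi_repr. Qed.

Lemma cproj_eq0 M (N : subcomodule M) m : cproj N m = 0 <-> N m.
Proof. exact: qpi_eq0. Qed.

Lemma cproj0 M (N : subcomodule M) m : N m -> cproj N m = 0.
Proof. by move=> /cproj_eq0. Qed.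

Lemma cimage M N (f : chom M N) (A : subcomodule M) :
  {B : subcomodule N | forall y, B y <-> exists2 x, A x & y = f x}.
Proof.
apply: subcom_pack => [|a _ _ [u Au ->] [v Av ->]|g _ [u Au ->]].
- by exists 0; [exact: sub_mem0 | rewrite linear0].
- by exists (a *: u + v); [exact: sub_memP | rewrite linearP].
- by exists (act M g u); [exact: subc_act | rewrite chom_act].
Qed.

Lemma cpreim M N (f : chom M N) (B : subcomodule N) :
  {A : subcomodule M | forall x, A x <-> B (f x)}.
Proof.
apply: subcom_pack => [|a u v Bu Bv|g u Bu].
- by rewrite linear0; exact: sub_mem0.
- by rewrite linearP; exact: sub_memP.
- by rewrite chom_act; exact: subc_act.
Qed.

Lemma cker M N (f : chom M N) :
  {A : subcomodule M | forall x, A x <-> f x = 0}.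
Proof.
apply: subcom_pack => [|a u v|g u hu].
- exact: linear0.
- by rewrite linearP => -> ->; rewrite scaler0 addr0.
- by rewrite chom_act hu linear0.
Qed.

Lemma cfull M : {A : subcomodule M | forall x, A x <-> True}.
Proof. by apply: subcom_pack. Qed.

Lemma chom_inj0 M N (f : chom M N) : (forall x, f x = 0 -> x = 0) -> injective f.
Proof.
move=> h x y fxy; apply/eqP; rewrite -subr_eq0; apply/eqP/h.
by rewrite linearB /= fxy subrr.
Qed.

Lemma chom_lift M N P (f : chom M N) (h : chom P N) : injective f ->
  (forall p, exists m, h p = f m) -> exists g : chom P M, forall p, f (g p) = h p.
Proof.
move=> f_inj hf; pose g p := projT1 (cid (hf p)).
have gE p : f (g p) = h p by rewrite /g; case: cid.
have g_lin : linear g by move=> a x y; apply: f_inj; rewrite linearP !gE linearP.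
have g_act k p : g (act P k p) = act M k (g p).
  by apply: f_inj; rewrite chom_act !gE chom_act.
have [G GE] := chom_pack g_lin g_act.
by exists G => p; rewrite GE.
Qed.

Lemma chom_desc M N P (f : chom M N) (h : chom M P) :
  (forall n, exists m, f m = n) -> (forall m, f m = 0 -> h m = 0) ->
  exists g : chom N P, forall m, g (f m) = h m.
Proof.
move=> f_surj hf; pose r n := projT1 (cid (f_surj n)).
have rK n : f (r n) = n by rewrite /r; case: cid.
have hE m n : f m = f n -> h m = h n.
  move=> e; apply/eqP; rewrite -subr_eq0; apply/eqP.
  by rewrite -linearB hf // linearB /= e subrr.
pose g n := h (r n).
have gE m : g (f m) = h m by apply: hE; rewrite rK.
have g_lin : linear g.
  by move=> a x y; rewrite -[x]rK -[y]rK -linearP !gE linearP.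
have g_act k p : g (act N k p) = act P k (g p).
  by rewrite -[p]rK -chom_act !gE chom_act.
have [G GE] := chom_pack g_lin g_act.
by exists G => p; rewrite GE.
Qed.

Lemma bij_cisom M N (f : chom M N) : injective f ->
  (forall n, exists m, f m = n) -> exists2 g : chom N M, cancel f g & cancel g f.
Proof.
move=> f_inj f_surj; have [p|g gE] := chom_lift (h := cidmap N) f_inj.
  by have [m <-] := f_surj p; exists m.
by exists g => x; [apply: f_inj|]; rewrite gE.
Qed.

Lemma cisom_sym M N : cisom M N -> cisom N M.
Proof. by move=> [f [g [fg gf]]]; exists g, f. Qed.

Lemma cisom_trans M N P : cisom M N -> cisom N P -> cisom M P.
Proof.
move=> [f [f' [h1 h2]]] [g [g' [h3 h4]]].
exists (ccomp g f), (ccomp f' g'); split=> x /=; by rewrite ?h3 ?h2 ?h1 ?h4.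
Qed.

(** * Simple comodules, Schur's lemma and simple subquotients *)

Lemma simple_chom_inj M N (f : chom M N) : simple M ->
  (exists m, f m <> 0) -> injective f.
Proof.
move=> [_ hM] [m fm]; have [A AE] := cker f.
apply: chom_inj0 => x; have [h|h] := hM A; first by move=> fx; apply/h/AE.
by exfalso; apply/fm/AE.
Qed.

Lemma simple_chom_surj M N (f : chom M N) : simple N ->
  (exists m, f m <> 0) -> forall n, exists m, f m = n.
Proof.
move=> [_ hN] [m fm] n; have [A AE] := cfull M; have [B BE] := cimage f A.
have [h|h] := hN B; last by have /BE[x _ ->] := h n; exists x.
by exfalso; apply/fm/h/BE; exists m => //; apply/AE.
Qed.

Lemma simple_cisom M N (f : chom M N) : simple M -> simple N ->
  (exists m, f m <> 0) -> cisom M N.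
Proof.
move=> sM sN hf.
have [g fg gf] := bij_cisom (simple_chom_inj sM hf) (simple_chom_surj sN hf).
by exists f, g.
Qed.

(** Simplicity is read inside [M], so that later arguments need not pass through subcomodules of the
    subtype [subcom A]. *)
Lemma simple_subcomP M (A : subcomodule M) : simple (subcom A) <->
  (exists2 x, A x & x <> 0) /\
  (forall B : subcomodule M, (forall x, B x -> A x) ->
     (exists2 x, B x & x <> 0) -> forall x, A x -> B x).
Proof.
split=> [[[a a0] h]|[[a Aa a0] h]].
  split.
    exists (\val a); first exact: subsp_valP.
    by move=> e; apply: a0; apply: val_inj; rewrite e linear0.
  move=> B BA [b Bb b0] x Ax; have [D DE] := cpreim (cincl A) B.
  have [e|e] := h D; last by have /DE := e (subsp_of Ax).
  exfalso; apply: b0; have := e (subsp_of (BA _ Bb)) => e1.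
  by rewrite -[b]/(\val (subsp_of (BA _ Bb))) e1 //; apply/DE.
split.
  by exists (subsp_of Aa) => e; apply: a0; rewrite -[a]/(\val (subsp_of Aa)) e.
move=> N; have [B BE] := cimage (cincl A) N.
case: (pselect (exists2 x, B x & x <> 0)) => [hB|nB]; [right|left] => m.
  have BA x : B x -> A x.
    by move=> /BE[y _ ->]; exact: subsp_valP.
  have /BE[y Ny e] := h B BA hB _ (subsp_valP m).
  by have -> : m = y by apply: val_inj.
move=> Nm; apply: val_inj; rewrite linear0; apply: contrapT => m0; apply: nB.
by exists (\val m) => //; apply/BE; exists m.
Qed.

Lemma simple_quotcomP M (A : subcomodule M) :
  (exists x, ~ A x) ->
  (forall B : subcomodule M, (forall x, A x -> B x) ->
     (exists2 x, B x & ~ A x) -> forall x, B x) -> simple (quotcom A).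
Proof.
move=> [a nAa] h; split; first by exists (cproj A a) => /cproj_eq0.
move=> N; have [B BE] := cpreim (cproj A) N.
case: (pselect (exists2 x, B x & ~ A x)) => [hB|nB]; [right|left] => y.
  have [m <-] := cproj_surj y; apply/BE/h => // x Ax; apply/BE.
  rewrite (cproj0 Ax); exact: sub_mem0.
have [m <-] := cproj_surj y => /BE Bm; apply: cproj0; apply: contrapT => nAm.
by apply: nB; exists m.
Qed.

Lemma simple_cyc M (m : M) : simple M -> m <> 0 -> forall x, exists f, x = act M f m.
Proof.
move=> [_ h] m0 x; have [e|e] := h (cyc m); last exact: e.
by exfalso; apply/m0/e/cyc_mem.
Qed.

Lemma simple_subcom_eq M (A B : subcomodule M) : simple (subcom A) ->
  simple (subcom B) -> (exists x, [/\ A x, B x & x <> 0]) ->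
  forall x, A x <-> B x.
Proof.
move=> /simple_subcomP[_ hA] /simple_subcomP[_ hB] [x [Ax Bx x0]] y.
have hx : exists2 z, cyc x z & z <> 0 by exists x => //; exact: cyc_mem.
split=> hy.
  by apply: (cyc_min Bx); exact: (hA _ (cyc_min Ax) hx).
by apply: (cyc_min Ax); exact: (hB _ (cyc_min Bx) hx).
Qed.

(** The map sends f m to f n; it is well defined because the annihilator of [m] annihilates [n]. *)
Lemma cyc_chom M N (m : M) (n : N) :
  (forall x, exists f, x = act M f m) ->
  (forall f, act M f m = 0 -> act N f n = 0) ->
  exists g : chom M N, g m = n.
Proof.
move=> hm hn; pose r x := projT1 (cid (hm x)).
have rE x : x = act M (r x) m by rewrite /r; case: cid.
have hE f g : act M f m = act M g m -> act N f n = act N g n.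
  move=> e; apply/eqP; rewrite -subr_eq0; apply/eqP.
  have sE (L : comodule C) (l : L) :
      act L (g \- f) l = act L g l - act L f l.
    rewrite !actE; move: (coact L l).
    apply: (tensor_ext (g := tcontr L g \- tcontr L f)) => u v /=.
    by rewrite !tcontrE /= scalerBl.
  by rewrite -opprB -sE hn ?oppr0 // sE e subrr.
pose g x := act N (r x) n.
have gE f : g (act M f m) = act N f n by apply: hE; rewrite -rE.
have g_lin : linear g.
  move=> a x y; rewrite [in LHS](rE x) [in LHS](rE y).
  have DE (L : comodule C) (l : L) : act L ((a \*: r x) \+ r y) l =
      a *: act L (r x) l + act L (r y) l.
    rewrite !actE; move: (coact L l).
    apply: (tensor_ext (g := (a \*: tcontr L (r x)) \+ tcontr L (r y))) => u v /=.
    by rewrite !tcontrE /= scalerDl scalerA.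
  by rewrite -DE gE DE.
have g_act k p : g (act M k p) = act N k (g p).
  by rewrite [in LHS](rE p) act_act gE -act_act.
have [G GE] := chom_pack g_lin g_act.
by exists G; rewrite GE -{1}[m]act_counit gE act_counit.
Qed.

(** Extend [j'] along [j] to [g], and split [g] by some [r]. A nonzero kernel of [g] or [r] would
    meet the essential image of [M], on which these maps restrict to the embeddings [j'] and [j]. *)
Lemma injective_envelope_uniq M E E' :
  injective_envelope M E -> injective_envelope M E' -> cisom E E'.
Proof.
move=> [iE [j [j_inj j_ess]]] [iE' [j' [j'_inj j'_ess]]].
have [g gE] := iE' _ _ j j' j_inj.
have g_inj : injective g.
  apply: chom_inj0 => x gx; apply: contrapT => x0; have [A AE] := cker g.
  have [|m /AE gm jm0] := j_ess A; first by exists x => //; apply/AE.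
  by apply: jm0; rewrite gE in gm; rewrite (j'_inj m 0) ?linear0.
have [r rE] := iE _ _ g (cidmap E) g_inj.
have r_inj : injective r.
  apply: chom_inj0 => x rx; apply: contrapT => x0; have [A AE] := cker r.
  have [|m /AE rm jm0] := j'_ess A; first by exists x => //; apply/AE.
  have jm : j m = 0 by have := rE (j m); rewrite gE rm.
  by apply: jm0; rewrite -gE jm linear0.
by exists g, r; split=> x; [|apply: r_inj]; rewrite rE.
Qed.

(** Zorn's lemma for the subcomodules of [A] that miss a nonzero element of [s]; finiteness of [s]
    makes this property pass to unions of chains. *)
Lemma max_subcomodule M (A : subcomodule M) (s : seq M) :
  (exists2 x, x \in s & x <> 0) ->
  exists B : subcomodule M, [/\ forall x, B x -> A x, exists2 x, x \in s & ~ B x &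
    forall B' : subcomodule M, (forall x, B' x -> A x) -> (forall x, B x -> B' x) ->
      (exists2 x, B' x & ~ B x) -> forall x, x \in s -> B' x].
Proof.
move=> [x0 x0s x0n0].
(* The union of the empty chain is empty, so [good] cannot ask for 0. The missed element is required
   to be nonzero so that 0 can be added back when [B] is formed. *)
pose good (X : set M) := [/\ forall (a : K) u v, X u -> X v -> X (a *: u + v),
  forall f u, X u -> X (act M f u), forall u, X u -> A u &
  exists2 x, x \in s & x <> 0 /\ ~ X x].
have [F FP Ftot|X [[Xcl Xact XA [x xs [xn0 nXx]]] Xmax]] := @Zorn_bigcup M good.
  split=> [a u v [Y FY Yu] [Z FZ Zv]|f u [Y FY Yu]|u [Y FY Yu]|].
  - have [YZ|ZY] := Ftot Y Z FY FZ.
      by exists Z => //; have [h _ _ _] := FP Z FZ; apply: h => //; exact: YZ.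
    by exists Y => //; have [h _ _ _] := FP Y FY; apply: h => //; exact: ZY.
  - by exists Y => //; have [_ h _ _] := FP Y FY; exact: h.
  - by have [_ _ h _] := FP Y FY; exact: h.
  (* If the union contained all nonzero elements of the finite list [s], a single member of the
     chain would contain them. *)
  apply: contrapT => hn.
  have hs x : x \in s -> x <> 0 -> (\bigcup_(X in F) X)%classic x.
    by move=> xs xn; apply: contrapT => nx; apply: hn; exists x.
  have [Y0 FY0 _] := hs _ x0s x0n0.
  have chain (t : seq M) :
      (forall x, x \in t -> x <> 0 -> (\bigcup_(X in F) X)%classic x) ->
      exists2 Y, F Y & forall x, x \in t -> x <> 0 -> Y x.
    elim: t => [|y t ih] {}hs; first by exists Y0.
    have [|Y FY hY] := ih.
      by move=> x xt; apply: hs; rewrite inE xt orbT.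
    case: (pselect (y = 0)) => [y0|y0].
      by exists Y => // x; rewrite inE => /orP[/eqP -> //|]; exact: hY.
    have [|Z FZ Zy] := hs y _ y0; first by rewrite inE eqxx.
    have [YZ|ZY] := Ftot Y Z FY FZ.
      exists Z => // x; rewrite inE => /orP[/eqP -> //|xt xn].
      by apply: YZ; exact: hY.
    exists Y => // x; rewrite inE => /orP[/eqP -> _|xt xn]; first exact: ZY.
    exact: hY.
  have [Y FY hY] := chain s hs; have [_ _ _ [x xs [xn nYx]]] := FP Y FY; exact/nYx/hY.
have [B BE] : {B : subcomodule M | forall m, B m <-> m = 0 \/ X m}.
  apply: subcom_pack => [|a u v|f m [->|Xm]]; first by left.
    move=> [->|Xu] [->|Xv]; rewrite ?scaler0 ?add0r ?addr0; [by left|by right| |].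
      (* [X] may lack 0, so the multiple of [u] by [a] is written as (a - 1) u + u. *)
      by right; have := Xcl (a - 1) _ _ Xu Xu; rewrite scalerBl scale1r subrK.
    by right; exact: Xcl.
  by left; rewrite linear0.
  by right; exact: Xact.
exists B; split=> [y /BE[->|/XA //]||B' B'A BB' [y B'y nBy] z zs].
- exact: sub_mem0.
- by exists x => // /BE[].
apply: contrapT => nB'z; apply: (Xmax (fun m => B' m)).
  split=> [u Xu|h]; first by apply/BB'/BE; right.
  by apply/nBy/BE; right; exact: h.
split=> //; first by move=> a u v; exact: sub_memP.
  by move=> f u; exact: subc_act.
exists z => //; split=> // z0; apply: nB'z; rewrite z0; exact: sub_mem0.
Qed.

(** A nonzero finitely generated [A] has a maximal proper subcomodule [B]. The simple quotient A/B
    is kept as a subcomodule [Q] of M/B, so that maps on it can be extended to M/B and M/B can serve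
    as an extension. *)
Lemma simple_subquotient M (A : subcomodule M) (s : seq M) :
  (forall x, x \in s -> A x) ->
  (forall B : subcomodule M, (forall x, x \in s -> B x) -> forall x, A x -> B x) ->
  (exists2 x, A x & x <> 0) ->
  exists B : subcomodule M,
    exists Q : subcomodule (quotcom B), [/\ forall x, B x -> A x,
      exists2 x, x \in s & ~ B x,
      forall y, Q y <-> exists2 x, A x & y = cproj B x & simple (subcom Q)].
Proof.
move=> sA As [a Aa a0].
have [|B [BA [x xs nBx] Bmax]] := @max_subcomodule M A s.
  apply: contrapT => h; apply: a0.
  have [Z ZE] : {Z : subcomodule M | forall m, Z m <-> m = 0}.
    apply: subcom_pack => // [b u v -> ->|f m ->]; first by rewrite scaler0 addr0.
    exact: linear0.
  apply/ZE/(As Z) => // y ys; apply/ZE; apply: contrapT => y0; apply: h; by exists y.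
exists B; have [Q QE] := cimage (cproj B) A; exists Q; split=> //.
  by exists x.
apply/simple_subcomP; split.
  exists (cproj B x); first by apply/QE; exists x => //; exact: sA.
  by move=> /cproj_eq0.
move=> Q' Q'Q [y Q'y y0] z /QE[w Aw ->].
have [B'' B''E] := cpreim (cproj B) Q'.
have B''A u : B'' u -> A u.
  move=> /B''E/Q'Q/QE[v Av e].
  rewrite -(subrK v u); apply: sub_memD => //; apply: BA; apply: (proj1 (cproj_eq0 B _)).
  by rewrite linearB /= e subrr.
apply/B''E; apply: (As B'') => //; apply: Bmax => //.
  move=> u Bu; apply/B''E; rewrite (cproj0 Bu); exact: sub_mem0.
have [v _ yE] := proj1 (QE y) (Q'Q _ Q'y); exists v.
  by apply/B''E; rewrite -yE.
by move=> /cproj_eq0 h; apply: y0; rewrite yE.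
Qed.

End Act.

(** * Idempotents acting on simple comodules *)

Section Dichotomy.
Variables (K : fieldType) (C : coalgebra K).
Implicit Types M N S : comodule C.

(** The coefficient map m |-> sum f(m_(0)) m_(1), which realizes the correspondence between
    functionals on [M] and comodule maps from [M] to [C]. For [M = regular C] it is [ractf f]. *)
Definition coefmap_fun M (f : {linear M -> K^o}) : {linear M -> C} :=
  tcontl C f \o coact M.

Lemma coefmap_coact M (f : {linear M -> K^o}) m :
  coact (regular C) (coefmap_fun f m) = tmap (coefmap_fun f) idfun (coact M m).
Proof.
transitivity (tcontl (C ⊗ C) f (tmap idfun (comul C) (coact M m))).
  by rewrite tcontl_tmap; congr (comul C _); exact: eq_tcontl.
by rewrite -coactA tcontl_assoc tmap_comp; exact: eq_tmap.
Qed.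

Definition coefmap M (f : {linear M -> K^o}) : chom M (regular C) :=
  @CHom K C M (regular C) (coefmap_fun f) (coefmap_coact f).

(** The counit recovers [f], so a nonzero functional yields a nonzero map to [C], and a simple
    comodule embeds in [C]. *)
Lemma counit_coefmap M (f : {linear M -> K^o}) m : counit C (coefmap f m) = f m.
Proof.
rewrite -[RHS](congr1 f (coact1 m)) /= /coefmap_fun /=; move: (coact M m).
apply: (tensor_ext (f := counit C \o tcontl C f) (g := f \o tcontr M (counit C))).
by move=> u v; rewrite /= tcontrE tcontlE !linearZ /=; exact: mulrC.
Qed.

Lemma simple_embeds S : simple S -> exists f : chom S (regular C), injective f.
Proof.
move=> sS; have [[m m0] _] := sS; have [f f1] := functional_neq0 m0.
exists (coefmap f); apply: simple_chom_inj => //; exists m => h.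
by have := counit_coefmap f m; rewrite h linear0 f1 => /esym/eqP; rewrite oner_eq0.
Qed.

Lemma simple_image M N (f : chom M N) : simple M -> (exists m, f m <> 0) ->
  exists B : subcomodule N, [/\ forall y, B y <-> exists x, y = f x,
    simple (subcom B) & cisom M (subcom B)].
Proof.
move=> sM [m0 fm0]; have [A AE] := cfull M; have [B BE0] := cimage f A.
have BE y : B y <-> exists x, y = f x.
  by rewrite BE0; split=> [[x _ ->]|[x ->]]; exists x => //; apply/AE.
have sB : simple (subcom B).
  apply/simple_subcomP; split; first by exists (f m0) => //; apply/BE; exists m0.
  move=> B' B'B [y B'y y0] z /BE[x ->]; have [A' A'E] := cpreim f B'.
  apply/A'E; have [h|] := sM.2 A'; last exact.
  have /BE[w yw] := B'B _ B'y; exfalso; apply: y0; rewrite yw (h w) ?linear0 //.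
  by apply/A'E; rewrite -yw.
exists B; split=> //.
have [||g gE] := @chom_lift K C _ _ _ (cincl B) f.
- exact: val_inj.
- move=> p; have Bfp : B (f p) by apply/BE; exists p.
  by exists (subsp_of Bfp).
by apply: (simple_cisom (f := g)) => //; exists m0 => h; apply: fm0;
  rewrite -gE h linear0.
Qed.

(** Write a nonzero [x] of [N] as a sum of components. By independence the annihilator of [x] kills
    each component, so each nonzero one gives an isomorphism from [N] to its summand. The summands
    are pairwise non-isomorphic, hence only one component is nonzero. *)
Lemma simple_sub_direct_sum M (A : subcomodule M) (J : eqType)
    (F : J -> subcomodule M) (N : subcomodule M) :
  (forall j, simple (subcom (F j))) ->
  (forall i j, cisom (subcom (F i)) (subcom (F j)) -> i = j) ->
  direct_sum A F -> simple (subcom N) -> (forall x, N x -> A x) ->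
  exists j, forall x, N x <-> F j x.
Proof.
move=> sF F_inj [AE F_indep] sN NA.
have /simple_subcomP[[x Nx x0] _] := sN.
have [s0 [y0 [Fy0 xE0]]] := proj1 (AE x) (NA x Nx).
(* The expansion of [x] may repeat indices while independence is stated for [uniq] lists, so
   repeated terms are collected with their multiplicity. *)
pose s := undup s0; pose y j := y0 j *+ count_mem j s0.
have Fy j : F j (y j).
  rewrite /y; elim: (count_mem _ _) => [|n ih]; first exact: sub_mem0.
  by rewrite mulrS; exact: sub_memD.
have us : uniq s by exact: undup_uniq.
have xE : x = \sum_(j <- s) y j.
  by rewrite xE0 -[LHS]big_undup_iterop_count.
have iso j : j \in s -> y j <> 0 -> cisom (subcom N) (subcom (F j)).
  move=> js yj0; pose x' := subsp_of Nx; pose y' := subsp_of (Fy j).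
  have x'0 : (x' : subcom N) <> 0 by move=> h; apply: x0; rewrite -[x]/(\val x') h.
  have [|g gE] := @cyc_chom _ _ (subcom N) (subcom (F j)) x' y' (simple_cyc sN x'0).
    move=> f h; apply: val_inj; rewrite subcom_act linear0 /=.
    apply: (F_indep s (fun i => act M f (y i))) => //.
      by move=> i; exact: subc_act.
    by rewrite -linear_sum -xE -[x]/(\val x') -subcom_act h.
  apply: (simple_cisom (f := g)) => //; exists x' => h; apply: yj0.
  by rewrite -[y j]/(\val y') -gE h.
have [j js yj0] : exists2 j, j \in s & y j <> 0.
  apply: contrapT => h; apply: x0; rewrite xE big_seq big1 // => j js.
  by apply: contrapT => yj; apply: h; exists j.
exists j; apply: simple_subcom_eq => //; exists x; split=> //.
rewrite xE (bigD1_seq j) //= big_seq_cond big1 ?addr0 // => i /andP[iS ij].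
apply: contrapT => yi0; move/eqP: ij; apply; apply: F_inj.
exact: cisom_trans (cisom_sym (iso i iS yi0)) (iso j js yj0).
Qed.

Hypothesis C_basic : basic C.

(* A simple comodule has multiplicity one in the socle of C, so its copy in C
   is also stable under the right action of C^*. *)
Lemma basic_simple_stable (N : subcomodule (regular C)) :
  simple (subcom N) -> forall (f : chom (regular C) (regular C)) x, N x -> N (f x).
Proof.
have [J [F [sF F_inj dF]]] := C_basic.
have key (L : subcomodule (regular C)) :
    simple (subcom L) -> exists j, forall x, L x <-> F j x.
  move=> sL; apply: (simple_sub_direct_sum sF F_inj dF sL) => x Lx.
  exists [:: x]; last by rewrite big_seq1.
  by move=> z; rewrite inE => /eqP ->; exists L.
have trans (L L' : subcomodule (regular C)) :
    (forall x, L x <-> L' x) -> cisom (subcom L) (subcom L').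
  move=> LL'; have [||g gE] := @chom_lift _ _ _ _ _ (cincl L') (cincl L).
  - exact: val_inj.
  - by move=> p; exists (subsp_of (proj1 (LL' _) (subsp_valP p))).
  have [||g' g'1 g'2] := @bij_cisom _ _ _ _ g.
  - by move=> u v uv; apply: val_inj; have := gE u; rewrite uv gE.
  - move=> n; exists (subsp_of (proj2 (LL' _) (subsp_valP n))).
    by apply: val_inj; exact: gE.
  by exists g, g'.
move=> sN f x Nx; case: (pselect (f x = 0)) => [->|fx0]; first exact: sub_mem0.
have [|B [BE sB isoB]] := @simple_image _ _ (ccomp f (cincl N)) sN.
  by exists (subsp_of Nx).
have [j Nj] := key N sN; have [k Bk] := key B sB.
have jk : j = k.
  apply: F_inj; apply: cisom_trans (cisom_sym (trans _ _ Nj)) _.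
  by apply: cisom_trans isoB (trans _ _ Bk).
apply/Nj; rewrite jk; apply/Bk/BE; by exists (subsp_of Nx).
Qed.

(** On a copy [N] of [S] in [C], the idempotent comodule map c |-> ce is 0 or the identity, so on
    [N] the functional [e] is 0 or the counit. Since [N] is stable under every [ractf g], the
    identity g(ec) = e([ractf g c]) carries this over to c |-> ec. *)
Lemma basic_simple_eact (e : conv_idempotent C) S : simple S ->
  (forall m, eact e S m = 0) \/ (forall m, eact e S m = m).
Proof.
move=> sS; have [f f_inj] := simple_embeds sS.
have [[m0 m0n] _] := sS.
have [|N [NE sN _]] := simple_image (f := f) sS.
  by exists m0 => h; apply: m0n; apply: f_inj; rewrite h linear0.
pose r : chom (regular C) (regular C) := coefmap (M := regular C) e.
have rE c : r c = ract e c by [].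
have N_ract g c : N c -> N (ractf g c).
  exact: (basic_simple_stable sN (coefmap (M := regular C) g)).
have lactE (g : {linear C -> K^o}) c : g (lact e c) = e (ractf g c) by exact: lactf_ractf.
have e_lact : (forall c, N c -> e c = 0) \/ (forall c, N c -> e c = counit C c).
  case: (pselect (exists2 c, N c & r c <> 0)) => [[c0 Nc0 rc0]|h]; [right|left] => c Nc.
    have rc : ract e c = c.
      apply/eqP; rewrite -subr_eq0; apply/eqP.
      have /simple_subcomP[_ hN] := sN.
      apply: contrapT => d0; apply: rc0.
      (* [B] is the kernel of [r] on [N] and contains [ract e c - c]. Were this difference nonzero,
         [B] would be all of [N], against [r c0 <> 0]. *)
      have [B BE] : {B : subcomodule (regular C) | forall x, B x <-> N x /\ r x = 0}.
        apply: subcom_pack => [|a u v [Nu ru] [Nv rv]|g u [Nu ru]].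
        - by split; [exact: sub_mem0 | rewrite linear0].
        - by split; [exact: sub_memP | rewrite linearP ru rv scaler0 addr0].
        - by split; [exact: subc_act | rewrite chom_act ru linear0].
      apply: (proj2 (proj1 (BE c0) _)); apply: hN => //.
        by move=> x /BE[].
      exists (ract e c - c) => //; apply/BE; split.
        by apply: sub_memB => //; exact: N_ract.
      by rewrite linearB !rE ract_idem subrr.
    by rewrite -[in LHS]rc idem_ract -(counit_ract e c) rc.
  have := counit_ract e c; rewrite -rE; have -> : r c = 0.
    by apply: contrapT => rc; apply: h; exists c.
  by rewrite linear0.
have feact m : f (eact e S m) = lact e (f m) by exact: chom_eact.
have Nf m : N (f m) by apply/NE; exists m.
case: e_lact => h; [left|right] => m; apply: f_inj; rewrite feact.
  rewrite linear0; apply: functional_ext => g.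
  by rewrite lactE h ?linear0 //; exact: N_ract.
apply: functional_ext => g; rewrite lactE h; last exact: N_ract.
exact: (counit_coefmap (M := regular C) g).
Qed.

End Dichotomy.

(** * Torsion and the quotient functor *)

Section Torsion.
Variables (K : fieldType) (C : coalgebra K) (e : conv_idempotent C).
Implicit Types M N : comodule C.

Lemma torsionP M : torsion e M <-> forall m, eact e M m = 0.
Proof.
split=> [h m|h z]; last by apply: val_inj; rewrite -val_T h linear0.
have im : limage (eact e M) (eact e M m) by exists m.
exact: (congr1 val (h (subsp_of im))).
Qed.

Lemma T_fixesP M : T_fixes e M <-> forall m, eact e M m = m.
Proof.
split=> h m; last by exists m.
by have [n ->] := h m; rewrite eact_idem.
Qed.

(* e C^* e = C^* e, read on comodules: every eM is a subcomodule of M. *)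
Definition eact_closed := forall M (f : {linear C -> K^o}) (m : M),
  eact e M (act M f (eact e M m)) = act M f (eact e M m).

Lemma semicentral_lact : left_semicentral e -> forall c, lact e c = lract e c.
Proof.
move=> h c; have [|d cd] := proj1 (h (lact e c)); first by exists c.
have : ract e (lact e c) = lact e c by rewrite cd; exact: ract_idem.
by move=> <-.
Qed.

Lemma semicentral_eact : left_semicentral e -> eact_closed.
Proof.
move=> /semicentral_lact h M f m.
transitivity (act M ((f \o ractf e) \o lactf e) m).
  by rewrite -act_act; exact: act_actr.
rewrite [RHS](@act_act K C M e f m); apply: eq_act => c.
exact: (congr1 f (esym (h c))).
Qed.

(** Take the counit of the hypothesis for [regular C]: it yields g(ec) = g(ece) for every functional
    [g], and functionals separate points. *)
Lemma eact_semicentral : eact_closed -> left_semicentral e.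
Proof.
move=> h c; split=> [[d ->]|[d ->]]; last first.
  exists (ract e d); exact: (esym (lact_ract e d)).
exists d; apply: functional_ext => g.
have e_fix : lact e (lactf g (lact e d)) = lactf g (lact e d) by exact: (h (regular C)).
have := counit_lact e (lactf g (lact e d)).
rewrite e_fix (lactf_ractf g (counit C)) (lactf_ractf g e) => e1.
apply: etrans e1; congr (g _); exact: (esym (counitl _)).
Qed.

(** eE is a subcomodule. If it were nonzero, it would meet the essential image of [M], on which [e]
    acts as 0. *)
Lemma semicentral_stable : eact_closed -> stable e.
Proof.
move=> h M E [_ [j [j_inj j_ess]]] /torsionP tM; apply/torsionP => v.
apply: contrapT => ev0.
have [N NE] : {N : subcomodule E | forall x, N x <-> eact e E x = x}.
  apply: subcom_pack => [|a x y hx hy|f x hx].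
  - exact: linear0.
  - by rewrite linearP hx hy.
  - by rewrite -hx h.
have [|m /NE ejm jm0] := j_ess N.
  by exists (eact e E v) => //; apply/NE; exact: eact_idem.
by apply: jm0; rewrite -ejm -chom_eact tM linear0.
Qed.

(** The coaction of T(M) inserts [e] around both tensor factors. On the left it acts trivially
    because eM is a subcomodule, on the right because ece = ec and x = ex. *)
Lemma act_T M (f : {linear C -> K^o}) (x : Tfun e M) : eact_closed ->
  \val (act (Tfun e M) (f \o subincl (limage (lract e))) x) = act M f (\val x).
Proof.
move=> h; have sc := semicentral_lact (eact_semicentral h).
have hx : eact e M (act M f (\val x)) = act M f (\val x).
  by rewrite -(val_T x); exact: h.
rewrite -hx actE /= tcontr_tmap lcoresE; congr (eact e M _).
rewrite -[in RHS](val_T x); apply: etrans (esym (act_act e f _)); apply: eq_tcontr => c.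
exact: (congr1 f (esym (sc c))).
Qed.

Definition tcores M m : Tfun e M := lcores (eact e M) m.

Lemma tcores_act M (f : {linear C -> K^o}) m : eact_closed -> T_fixes e M ->
  tcores (act M f m) = act (Tfun e M) (f \o subincl (limage (lract e))) (tcores m).
Proof.
move=> h /T_fixesP hM; apply: val_inj; rewrite act_T // lcoresE /= [LHS]hM.
by congr (act M f _); rewrite [RHS]hM.
Qed.

(* Under [eact_closed] the left adjoint of T sends N to N itself, so that a map
   out of a comodule M = eM is the same as a map out of T(M). *)
Lemma T_lift M N (g : chom (Tfun e M) (Tfun e N)) : eact_closed -> T_fixes e M ->
  exists g' : chom M N, forall x, g' (\val x) = \val (g x).
Proof.
move=> h fM; have /T_fixesP hM := fM.
pose g' m := \val (g (tcores m)).
have g'_lin : linear g'.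
  move=> a x y; rewrite /g' /tcores !linearP; exact: (linearP (subincl _)).
have g'_act f m : g' (act M f m) = act N f (g' m).
  by rewrite /g' tcores_act // chom_act act_T.
have [G GE] := chom_pack g'_lin g'_act; exists G => x; rewrite GE.
congr (\val (g _)); apply: val_inj; rewrite lcoresE; exact: hM.
Qed.

Lemma Tmap_val M N (f : chom M N) x : \val (Tmap e f x) = f (\val x).
Proof. by []. Qed.

End Torsion.

(** * Corner comodules as C-comodules, and preservation of injective envelopes by T *)

Section Restriction.
Variables (K : fieldType) (C : coalgebra K) (e : conv_idempotent C).
Hypothesis eC_closed : eact_closed e.

Local Notation cval := (subincl (limage (lract e))).

Lemma lact_cval (x : corner e) : lact e (cval x) = cval x.
Proof.
rewrite (semicentral_lact (eact_semicentral eC_closed)); exact: val_corner.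
Qed.

(** In the comultiplication of the corner, the [e] on the right factor is absorbed because [e] fixes
    [cval x], and the one on the left because eC is a subcomodule. Hence [cval] is a coalgebra map,
    along which coactions can be extended. *)
Lemma cval_comul (x : corner e) :
  tmap cval cval (comul (corner e) x) = comul C (cval x).
Proof.
have sc := semicentral_lact (eact_semicentral eC_closed).
rewrite /= /corner_comul /= tmap_comp.
transitivity (tmap (lact e) (lact e) (comul C (cval x))).
  by apply: eq_tmap => c; rewrite sc.
apply: tensor_contr_ext => f; rewrite tcontr_tmap.
transitivity (lact e (tcontr C f (tmap idfun (lact e) (comul C (cval x))))).
  by rewrite tcontr_tmap.
rewrite -comul_lact; apply: etrans (congr1 (lactf f) (lact_cval x)).
exact: (eC_closed (M := regular C) f (cval x)).
Qed.

Section Object.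
Variable N : comodule (corner e).

Definition res_coact : {linear N -> N ⊗ C} := tmap idfun cval \o coact N.

Lemma res_coactA n :
  tassoc _ _ _ (tmap res_coact idfun (res_coact n)) =
  tmap idfun (comul C) (res_coact n).
Proof.
rewrite /res_coact /= !tmap_comp.
transitivity (tassoc N C C (tmap (tmap idfun cval) cval
    (tmap (coact N) idfun (coact N n)))).
  by rewrite tmap_comp; congr (tassoc _ _ _ _); exact: eq_tmap.
rewrite tassoc_nat coactA tmap_comp; apply: eq_tmap => // x.
exact: cval_comul.
Qed.

Lemma res_coact1 n : tcontr _ (counit C) (res_coact n) = n.
Proof.
rewrite /res_coact /= tcontr_tmap /= -[RHS]coact1; exact: eq_tcontr.
Qed.

Definition res : comodule C := Comodule res_coactA res_coact1.

Lemma act_res (f : {linear C -> K^o}) (n : N) :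
  act res f n = act N (f \o cval) n.
Proof. by rewrite !actE /= tcontr_tmap. Qed.

(** On the corner, [e] agrees with the counit of [C]. *)
Lemma eact_res (n : N) : eact e res n = n.
Proof.
transitivity (act res e n) => //; rewrite act_res -[RHS](@act_counit K (corner e) N).
apply: (@eq_act K (corner e) N) => x; rewrite /= -[X in _ = counit C X]lact_cval.
by rewrite counit_lact.
Qed.

End Object.

(** [res] keeps maps injective, and any map from [res B] to [E] lands in eE. So an extension problem
    into T(E) is solved in C-comodules and read back. *)
Lemma T_injective E : injective_comodule E -> injective_comodule (Tfun e E).
Proof.
move=> iE A B i f i_inj.
have i_act g a : i (act (res A) g a) = act (res B) g (i a).
  by rewrite !act_res chom_act.
have [ri riE] := @chom_pack K C (res A) (res B) i (fun a x y => linearP i a x y) i_act.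
have f_lin : linear (fun a : res A => \val (f a) : E).
  by move=> a x y; rewrite linearP; exact: (linearP (subincl _)).
have f_act g (a : res A) : \val (f (act (res A) g a)) = act E g (\val (f a)).
  by rewrite act_res chom_act act_T.
have [rf rfE] := @chom_pack K C (res A) E _ f_lin f_act.
have ri_inj : injective ri by move=> x y; rewrite !riE; exact: i_inj.
have [g gE] := iE _ _ ri rf ri_inj.
have gT (b : B) : limage (eact e E) (g b).
  by exists (g b); rewrite -chom_eact eact_res.
pose k (b : B) : Tfun e E := subsp_of (gT b).
have k_lin : linear k by move=> a x y; apply: val_inj; rewrite /= linearP.
have k_act (u : {linear corner e -> K^o}) b : k (act B u b) = act (Tfun e E) u (k b).
  (* Every functional on the corner is the restriction of one on [C], its composite with c |-> ece;
     this brings [act_T] into play. *)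
  have uE : u =1 ((u \o lcores (lract e)) \o cval).
    by move=> x /=; congr (u _); apply: val_inj; exact: (esym (val_corner x)).
  apply: val_inj; rewrite (eq_act b uE) (eq_act (k b) uE) act_T //.
  transitivity (g (act (res B) (u \o lcores (lract e)) b)); last exact: chom_act.
  by rewrite act_res.
have [G GE] := chom_pack k_lin k_act.
exists G => a; apply: val_inj; rewrite GE /= -rfE -gE; congr (g _); exact: (esym (riE a)).
Qed.

(** For essentiality, a nonzero subcomodule of T(E) is also a subcomodule of [E] and so contains
    some nonzero [j m]. As [e] fixes [j m] and [j] is injective, [e] fixes [m]. *)
Lemma T_injective_envelope M E :
  injective_envelope M E -> injective_envelope (Tfun e M) (Tfun e E).
Proof.
move=> [iE [j [j_inj j_ess]]]; split; first exact: T_injective.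
exists (Tmap e j); split.
  move=> x y xy; apply: val_inj; apply: j_inj.
  by rewrite -[LHS](Tmap_val j x) xy.
move=> N [z Nz z0].
have [N' N'E] : {N' : subcomodule E | forall v, N' v <-> exists2 x, N x & v = \val x}.
  apply: subcom_pack => [|a _ _ [x Nx ->] [y Ny ->]|f _ [x Nx ->]].
  - by exists 0; [exact: sub_mem0 | rewrite linear0].
  - exists (a *: x + y); first exact: sub_memP.
    by rewrite -[RHS]/(subincl _ _) linearP.
  - by exists (act (Tfun e E) (f \o cval) x); [exact: subc_act | rewrite act_T].
have [|m /N'E[x Nx jx] jm0] := j_ess N'.
  exists (\val z); first by apply/N'E; exists z.
  by move=> h; apply: z0; apply: val_inj; rewrite h linear0.
have em : eact e M m = m.
  by apply: j_inj; rewrite chom_eact jx; exact: val_T.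
have Tm : limage (eact e M) m by exists m.
exists (subsp_of Tm).
  by have -> : Tmap e j (subsp_of Tm) = x by apply: val_inj.
by move=> h; apply: jm0; rewrite -[j m]/(\val (Tmap e j (subsp_of Tm))) h linear0.
Qed.

End Restriction.

(** * Arrows of the Ext-quiver *)

Section Quiver.
Variables (K : fieldType) (C : coalgebra K).
Implicit Types M N : comodule C.

Lemma Ext1_neq0_cisom N M M' : cisom M M' -> Ext1_neq0 N M -> Ext1_neq0 N M'.
Proof.
move=> [f [g [fg gf]]] [X nX].
have inj : injective (ccomp (ext_in X) g).
  by move=> x y /(ext_inj (e := X)); exact: (can_inj gf).
have exact_at x : ext_out X x = 0 <-> exists m, ccomp (ext_in X) g m = x.
  rewrite ext_exact; split=> [[m <-]|[m <-]]; last by exists (g m).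
  by exists (f m); rewrite /= fg.
by exists (Extension inj (@ext_surj _ _ _ _ X) exact_at).
Qed.

(** Every simple subcomodule of [E] meets the simple image of [j] and so equals it. This identifies
    the first Loewy layer of E_x with S_x. *)
Lemma soc_essential M E (j : chom M E) : simple M -> injective j -> essential j ->
  cisom M (subcom (soc E)).
Proof.
move=> sM j_inj j_ess; have [[m0 m0n] _] := sM.
have [|B [BE sB isoB]] := simple_image (f := j) sM.
  by exists m0 => h; apply: m0n; apply: j_inj; rewrite h linear0.
have socB x : soc E x -> B x.
  move=> [s hs ->]; rewrite big_seq; elim/big_ind: _ => [|u v|y ys].
  - exact: sub_mem0.
  - exact: sub_memD.
  have [N sN Ny] := hs y ys; case: (pselect (y = 0)) => [->|y0]; first exact: sub_mem0.
  have [|m Nm jm0] := j_ess N; first by exists y.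
  by apply/(simple_subcom_eq sB sN) => //; exists (j m); split=> //; apply/BE; exists m.
have Bsoc x : B x -> soc E x.
  by move=> Bx; exists [:: x];
    [move=> z; rewrite inE => /eqP ->; exists B | rewrite big_seq1].
have [||g gE] := @chom_lift _ _ _ _ _ (cincl (soc E)) j.
- exact: val_inj.
- move=> p; have Bjp : B (j p) by apply/BE; exists p.
  by exists (subsp_of (Bsoc _ Bjp)).
have [||g' g1 g2] := @bij_cisom _ _ _ _ g.
- by move=> x y xy; apply: j_inj; rewrite -!gE xy.
- move=> n; have /BE[m nm] := socB _ (subsp_valP n).
  by exists m; apply: val_inj; rewrite nm; exact: gE.
by exists g, g'.
Qed.

Variables (I : Type) (S E : I -> comodule C).
Hypothesis S_complete : complete_simples S.
Hypothesis E_env : forall x, injective_envelope (S x) (E x).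

Lemma simple_S x : simple (S x). Proof. by have [h _ _] := S_complete. Qed.

(* The cyclic comodule generated by n has a simple quotient in which n survives. *)
Lemma hom_detect M (n : M) : n <> 0 ->
  exists x (s : S x) (j : chom (S x) (E x)) (g : chom M (E x)),
    [/\ injective j, g n = j s & s <> 0].
Proof.
move=> n0.
have [|||B [Q [BA [z zn nBz] QE sQ]]] := @simple_subquotient _ _ M (cyc n) [:: n].
- by move=> x; rewrite inE => /eqP ->; exact: cyc_mem.
- by move=> B hB; apply: cyc_min; apply: hB; rewrite inE.
- by exists n => //; exact: cyc_mem.
have {}nBz : ~ B n by move: zn nBz; rewrite inE => /eqP ->.
have [_ _ /(_ _ sQ)[x [f [f' [ff' _]]]]] := S_complete.
have [iE [j [j_inj _]]] := E_env x.
have Qn : Q (cproj B n) by apply/QE; exists n => //; exact: cyc_mem.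
have [|g gE] := iE _ _ (cincl Q) (ccomp j f); first exact: val_inj.
exists x, (f (subsp_of Qn)), j, (ccomp g (cproj B)); split=> //.
  exact: (gE (subsp_of Qn)).
move=> h; apply: nBz; apply/(cproj_eq0 B).
have := ff' (subsp_of Qn); rewrite h linear0 => /(congr1 val) /= <-.
by [].
Qed.

Variable e : conv_idempotent C.
Hypothesis C_basic : basic C.

Lemma S_cases x : torsion e (S x) \/ T_fixes e (S x).
Proof.
have [h|h] := basic_simple_eact C_basic e (simple_S x).
  by left; apply/torsionP.
by right; apply/T_fixesP.
Qed.

Lemma T_fixes_not_torsion x : T_fixes e (S x) -> ~ torsion e (S x).
Proof.
move=> /T_fixesP h /torsionP t; have [[m m0] _] := simple_S x.
by apply: m0; rewrite -[m]h t.
Qed.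

Lemma not_torsion_T_fixes x : ~ torsion e (S x) -> T_fixes e (S x).
Proof. by move=> h; case: (S_cases x). Qed.

Lemma not_T_fixes_torsion x : ~ T_fixes e (S x) -> torsion e (S x).
Proof. by move=> h; case: (S_cases x). Qed.

Lemma torsion_env_eact_closed :
  (forall x, torsion e (S x) -> torsion e (E x)) -> eact_closed e.
Proof.
move=> h M f m; apply/eqP; rewrite -subr_eq0; apply/eqP; apply: contrapT => n0.
set u := act M f _ in n0 *; have [x [s [j [g [j_inj gn s0]]]]] := hom_detect n0.
(* The difference is killed by [e], hence so is its image [s], which forces [S x] to be torsion. *)
have es : eact e (S x) s = 0.
  apply: j_inj; rewrite chom_eact -gn -chom_eact linearB eact_idem subrr.
  by rewrite !linear0.
have tS : torsion e (S x).
  have [//|/T_fixesP fS] := S_cases x; by exfalso; apply: s0; rewrite -es fS.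
have /torsionP tE := h x tS.
apply: s0; apply: j_inj; rewrite -gn linear0 linearB chom_eact tE sub0r.
by rewrite /u chom_act chom_eact tE linear0 oppr0.
Qed.

(** A nonzero [e v] in E_y survives in some E_x. As [e] fixes it, S_x is not torsion, and the map
    E_y -> E_x contradicts the hypothesis. *)
Lemma Hom_zero_torsion_env :
  (forall x y, ~ torsion e (S x) -> torsion e (S y) ->
     forall (f : chom (E y) (E x)) m, f m = 0) ->
  forall y, torsion e (S y) -> torsion e (E y).
Proof.
move=> h y tS; apply/torsionP => v; apply: contrapT => ev.
have [x [s [j [g [j_inj gn s0]]]]] := hom_detect ev.
have es : eact e (S x) s = s.
  by apply: j_inj; rewrite chom_eact -gn -chom_eact eact_idem.
have nx : ~ torsion e (S x) by move=> /torsionP t; apply: s0; rewrite -es t.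
by apply: s0; apply: j_inj; rewrite -gn linear0; exact: h.
Qed.

(** A nonzero image would meet S_x, where [e] is the identity, although [e] is 0 on E_y. *)
Lemma torsion_env_Hom_zero :
  (forall x, torsion e (S x) -> torsion e (E x)) ->
  forall x y, ~ torsion e (S x) -> torsion e (S y) ->
     forall (f : chom (E y) (E x)) m, f m = 0.
Proof.
move=> h x y nx ty f m; apply: contrapT => fm.
have [A AE] := cfull (E y); have [B BE] := cimage f A.
have [_ [j [j_inj j_ess]]] := E_env x.
have [|s /BE[u _ js] js0] := j_ess B.
  by exists (f m) => //; apply/BE; exists m => //; apply/AE.
have /T_fixesP fS := not_torsion_T_fixes nx.
have /torsionP tE := h y ty.
by apply: js0; rewrite -[s]fS chom_eact js -chom_eact tE linear0.
Qed.

(** T is exact and kills [M], so it makes the projection of the extension invertible. *)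
Lemma T_ext_out M N (X : extension N M) : torsion e M ->
  exists2 g : chom (Tfun e N) (Tfun e (ext_mid X)),
    cancel g (Tmap e (ext_out X)) & cancel (Tmap e (ext_out X)) g.
Proof.
move=> /torsionP tM; have [||g g1 g2] := @bij_cisom _ _ _ _ (Tmap e (ext_out X)).
- apply: chom_inj0 => z /(congr1 val); rewrite Tmap_val linear0 => /ext_exact[a az].
  by apply: val_inj; rewrite -val_T -az -chom_eact tM !linear0.
- move=> n; have [x xn] := ext_surj X (\val n).
  exists (tcores e x); apply: val_inj; rewrite Tmap_val lcoresE chom_eact xn.
  exact: val_T.
by exists g.
Qed.

(** The inverse of T applied to the projection lifts to a section by [T_lift]. *)
Lemma split_torsion_ext M N (X : extension N M) : eact_closed e ->
  torsion e M -> T_fixes e N -> split_extension X.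
Proof.
move=> h tM fN; have [g g1 _] := T_ext_out X tM.
have [s sE] := T_lift g h fN; exists s => n.
have <- : \val (tcores e n) = n by rewrite lcoresE; move/T_fixesP: fN.
by rewrite sE -Tmap_val g1.
Qed.

(** For a maximal proper subcomodule [B] of [A], the comodule M/B extends the torsion-free simple
    M/A by the torsion simple A/B. It cannot split: a section would reach the class of the generator
    [m], which [e] fixes, and would then be onto. *)
Lemma cyclic_arrow M (m : M) (A : subcomodule M) (s : seq M) :
  (forall x, cyc m x) -> eact e M m = m -> (forall x, A x -> eact e M x = 0) ->
  (exists2 x, A x & x <> 0) -> simple (quotcom A) ->
  (forall x, x \in s -> A x) ->
  (forall B : subcomodule M, (forall x, x \in s -> B x) -> forall x, A x -> B x) ->
  exists x y, [/\ arrow S x y, T_fixes e (S x) & torsion e (S y)].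
Proof.
move=> cyc_m em tA A0 sA As Aspan.
have [B [Q [BA [b bs nBb] QE sQ]]] := simple_subquotient As Aspan A0.
have [_ _ hS] := S_complete.
have [x [f [f' [ff' f'f]]]] := hS _ sA; have [y [k [k' [kk' k'k]]]] := hS _ sQ.
have [||p pE] := @chom_desc _ _ _ _ _ (cproj B) (cproj A).
- exact: cproj_surj.
- by move=> u /cproj_eq0 Bu; apply: cproj0; exact: BA.
have nAm : ~ A m.
  move=> Am; have [[z z0] _] := sA; apply: z0; have [u <-] := cproj_surj z.
  exact/cproj0/(cyc_min Am).
have em' : eact e (quotcom A) (cproj A m) = cproj A m by rewrite -chom_eact em.
have tSy : torsion e (S y).
  apply: not_T_fixes_torsion => /T_fixesP fS.
  have Qb : Q (cproj B b) by apply/QE; exists b => //; exact: As.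
  pose q : subcom Q := subsp_of Qb.
  have eq0 : eact e (subcom Q) q = 0.
    apply: val_inj; rewrite [LHS](subcom_act e) linear0 /=.
    apply: etrans (esym (chom_eact e (cproj B) b)) _.
    by rewrite tA ?linear0 //; exact: As.
  have kq0 : k q = 0 by rewrite -[k q]fS -chom_eact eq0 linear0.
  have q0 : q = 0 by rewrite -[q]kk' kq0 linear0.
  by apply: nBb; apply/(cproj_eq0 B); rewrite -[cproj B b]/(\val q) q0 linear0.
have fSx : T_fixes e (S x).
  apply: not_torsion_T_fixes => /torsionP tS; apply: nAm; apply/(cproj_eq0 A).
  by rewrite -[cproj A m]ff' -em' chom_eact tS linear0.
pose out := ccomp f p; pose inn := ccomp (cincl Q) k'.
have inn_inj : injective inn by move=> u v /val_inj; exact: (can_inj k'k).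
have out_surj n : exists z, out z = n.
  have [u uE] := cproj_surj (f' n); exists (cproj B u).
  by rewrite /= pE uE f'f.
have out_exact z : out z = 0 <-> exists a, inn a = z.
  split=> [|[a <-]].
    have [u <-] := cproj_surj z; rewrite /= pE => fu.
    have Qz : Q (cproj B u).
      apply/QE; exists u => //; apply/(cproj_eq0 A).
      by rewrite -[cproj A u]ff' fu linear0.
    by exists (k (subsp_of Qz)); rewrite /= kk'.
  have /QE[u Au uE] : Q (inn a) by exact: subsp_valP.
  by rewrite uE /= pE (cproj0 Au) linear0.
exists x, y; split=> //; exists (Extension inn_inj out_surj out_exact) => -[/= t tE].
have tE' n : f (p (t n)) = n by exact: tE.
pose v := t (out (cproj B m)).
have [a av] : exists a, inn a = cproj B m - v.
  by apply/out_exact; rewrite linearB /v /out /= tE' subrr.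
(* The difference lies in the torsion part A/B and is fixed by [e], so it is 0. *)
have mv : cproj B m = v.
  apply/eqP; rewrite -subr_eq0 -av; apply/eqP.
  have em2 : eact e (quotcom B) (cproj B m) = cproj B m by rewrite -chom_eact em.
  have ev : eact e (quotcom B) v = v by rewrite /v -!chom_eact em.
  have <- : eact e (quotcom B) (inn a) = inn a by rewrite av linearB em2 ev.
  by rewrite -chom_eact (proj1 (torsionP e _) tSy) linear0.
(* Since [m] generates [M], the class of [b] comes from the section; as the projection kills it, [b]
   would lie in [B]. *)
apply: nBb; apply/(cproj_eq0 B).
have [g bE] := cyc_m b.
have bt : cproj B b = t (act (S x) g (out (cproj B m))).
  by rewrite bE chom_act {1}mv [RHS]chom_act.
have : out (cproj B b) = 0 by rewrite /= pE (cproj0 (As _ bs)) linear0.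
by rewrite {1}bt /= tE' => e0; rewrite bt /= e0 linear0.
Qed.

Lemma no_arrow_torsion_env :
  (forall x y, arrow S x y -> T_fixes e (S x) -> ~ torsion e (S y)) ->
  forall y, torsion e (S y) -> torsion e (E y).
Proof.
move=> noarr y /torsionP tS; apply/torsionP => v0; apply: contrapT => ev0.
(* Minimizing the length of a spanning list for a subcomodule generated by some nonzero m = em
   replaces the choice of least dimension. *)
pose P k := `[< exists m s, [/\ m <> 0 :> E y, eact e (E y) m = m, size s = k &
  forall x, cyc m x -> sp (zero_subspace (E y)) s x] >].
have exP : exists k, P k.
  have [s hs] := cyc_span (eact e (E y) v0).
  exists (size s); apply/asboolP; exists (eact e (E y) v0), s; split=> //.
  exact: eact_idem.
case: (ex_minnP exP) => n /asboolP[m [s [m0 em sz ms]]] nmin.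
pose M := subcom (cyc m); pose m' : M := subsp_of (cyc_mem m).
have valA (f : {linear C -> K^o}) (x : M) : \val (act M f x) = act (E y) f (\val x).
  exact: subcom_act.
have val0 (x : M) : \val x = 0 -> x = 0 by move=> h; apply: val_inj; rewrite h linear0.
have cyc_m' x : cyc m' x.
  have [f fx] := subsp_valP x; exists f; apply: val_inj.
  by rewrite valA.
have em' : eact e M m' = m' by apply: val_inj; rewrite [LHS](valA e).
have m'0 : m' <> 0 by move=> /(congr1 val).
(* [A] is the largest torsion subcomodule of [M]. *)
have [A AE] : {A : subcomodule M | forall x, A x <-> forall f, eact e M (act M f x) = 0}.
  apply: subcom_pack => [f|a u w hu hw f|g u hu f].
  - by rewrite !linear0.
  - by rewrite !linearP hu hw scaler0 addr0.
  - by rewrite act_act.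
have tA x : A x -> eact e M x = 0 by move=> /AE/(_ (counit C)); rewrite act_counit.
(* The essential copy of the torsion comodule [S y] in [E y] meets [cyc m]. *)
have A0 : exists2 x, A x & x <> 0.
  have [_ [j [_ j_ess]]] := E_env y.
  have [|a ja ja0] := j_ess (cyc m); first by exists m => //; exact: cyc_mem.
  pose ja' : M := subsp_of ja.
  exists ja'; last by move=> /(congr1 val).
  apply/AE => f; apply: val0.
  transitivity (j (eact e (S y) (act (S y) f a))); last by rewrite tS linear0.
  by rewrite [LHS](valA e) valA chom_eact chom_act.
have [r rK] := retract_exists (cyc m).
(* The vectors of [s] need not lie in [cyc m]; the retraction moves them there without losing the
   span. *)
pose sM : seq M := map r s.
have spM (x : M) : sp (zero_subspace M) sM x.
  have := @sp_map _ _ _ r (zero_subspace (E y)) (zero_subspace M) s (\val x).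
  by rewrite rK; apply; [move=> _ ->; exact: linear0 | apply/ms/subsp_valP].
(* A subcomodule [B] properly containing [A] has a nonzero vector [w] fixed by [e]. If [B] were not
   all of [M], the subcomodule generated by [w] would be spanned by a shorter list, against
   minimality. *)
have sA : simple (quotcom A).
  apply: simple_quotcomP; first by exists m' => /tA; rewrite em'.
  move=> B AB [b Bb nAb] z; apply: contrapT => nBz.
  have [f ef] : exists f, eact e M (act M f b) <> 0.
    by apply: contrapT => h; apply: nAb; apply/AE => f;
      apply: contrapT => hf; apply: h; exists f.
  set w := eact e M _ in ef.
  have Bw : B w by rewrite /w; apply: (subc_act (N := B)); exact: subc_act.
  have [|||s' [ss' _ Bs']] := @sp_proper _ M B sM z => //.
  suff /nmin : P (size s') by rewrite -sz -(size_map r s) [size _]ss' ltnn.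
  apply/asboolP; exists (\val w), (map (subincl (cyc m)) s'); split.
  - by move=> /val0.
  - by rewrite -[LHS](valA e) [act _ _ _]eact_idem.
  - by rewrite size_map.
  - move=> x [g ->]; rewrite -valA.
    apply: (@sp_map _ _ _ (subincl (cyc m)) (zero_subspace M)); last exact/Bs'/subc_act.
    by move=> _ ->; exact: linear0.
(* As a subspace of a finitely spanned comodule, [A] has a finite generating list of its own, as
   [cyclic_arrow] demands. *)
have [sA' [_ h1 h2]] := @sp_generators _ M A sM (fun x _ => spM x).
have [|x [z [arr fx tz]]] := @cyclic_arrow M m' A sA' cyc_m' em' tA A0 sA h1.
  move=> B hB u Au; apply: sp_least (h2 _ Au) => // _ ->; exact: sub_mem0.
exact: noarr arr fx tz.
Qed.

End Quiver.

(** * The left adjoint of the quotient functor *)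

Section Adjoint.
Variables (K : fieldType) (C : coalgebra K) (e : conv_idempotent C).
Variable H : left_adjoint e.

(** The counit [eps] of the adjunction is inverted by [g], the lift through [T_lift] of the unit N
    -> T(H N). One composite is checked by injectivity of [ladj_hom], the other by evaluating the
    triangle identity. *)
Lemma ladj_T_cisom M : eact_closed e -> T_fixes e M -> cisom (H (Tfun e M)) M.
Proof.
move=> h fM; pose N := Tfun e M.
have [hinv _ hK] := ladj_hom_bij H N M.
have [g gE] := T_lift (ladj_hom (cidmap (H N))) h fM.
pose eps := hinv (cidmap N); have epsE : ladj_hom eps = cidmap N by exact: hK.
have gN m : g m = \val (ladj_hom (cidmap (H N)) (tcores e m)).
  by rewrite -gE lcoresE; congr (g _); move/T_fixesP: fM.
have Tg : Tmap e g = ladj_hom (cidmap (H N)).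
  by apply: chom_ext => x; apply: val_inj; rewrite Tmap_val gE.
exists eps, g; split=> z.
  have [k kK _] := ladj_hom_bij H N (H N).
  have : ladj_hom (ccomp g eps) = ladj_hom (cidmap (H N)).
    by rewrite ladj_natr epsE -Tg; exact: chom_ext.
  by move=> /(can_inj kK) /(congr1 (fun u : chom (H N) (H N) => u z)).
have := ladj_natr eps (cidmap (H N)).
rewrite (_ : ccomp eps (cidmap (H N)) = eps); last exact: chom_ext.
rewrite epsE => /(congr1 (fun u : chom N N => \val (u (tcores e z)))).
move=> e1; rewrite [g z]gN; apply: etrans (esym e1) _.
exact: (proj1 (T_fixesP e M) fM z).
Qed.

(** Let [u] be the adjoint of the inverse of T([ext_out X]). Then [ext_out X] after [u] corresponds
    to an identity, so it is nonzero; through H(T(N)) = N it becomes a nonzero endomorphism [v] of a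
    simple comodule, and inverting [v] gives a section. *)
Lemma ladj_split_torsion_ext M N (X : extension N M) :
  simple N -> cisom (H (Tfun e N)) N -> torsion e M -> T_fixes e N ->
  split_extension X.
Proof.
move=> sN [f [f' [ff' f'f]]] tM /T_fixesP fN; have [g g1 _] := T_ext_out X tM.
have [hinv _ hK] := ladj_hom_bij H (Tfun e N) (ext_mid X).
pose u := hinv g; pose v := ccomp (ccomp (ext_out X) u) f'.
have outu : ladj_hom (ccomp (ext_out X) u) = cidmap (Tfun e N).
  by rewrite ladj_natr hK; apply: chom_ext => x; exact: g1.
have v0 : exists n, v n <> 0.
  apply: contrapT => h; have [[n n0] _] := sN; apply: n0.
  (* [z] is the zero endomorphism of [N]. If [v] vanished, composing with [z] would not change the
     map corresponding to the identity, so T(z) would be the identity of T(N). *)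
  have [|k m|z zE] := @chom_pack K C N N (fun=> 0); last 1 first.
  have uz : ccomp z (ccomp (ext_out X) u) = ccomp (ext_out X) u.
    apply: chom_ext => x; rewrite [LHS]zE; apply: esym; apply: contrapT => hx.
    by apply: h; exists (f x); rewrite /= ff'.
  have := ladj_natr z (ccomp (ext_out X) u); rewrite uz outu.
  move=> /(congr1 (fun k : chom (Tfun e N) (Tfun e N) => \val (k (tcores e n)))).
  by move=> e1; rewrite -[LHS]fN; apply: etrans e1 _; exact: zE.
  - by move=> a x y; rewrite scaler0 addr0.
  - by rewrite linear0.
have [w _ w2] := bij_cisom (simple_chom_inj sN v0) (simple_chom_surj sN v0).
by exists (ccomp (ccomp u f') w) => n; exact: w2.
Qed.

End Adjoint.

(** * The cycle of implications from (a) to (h), and condition (i) *)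

Theorem theorem6p1 (K : fieldType) (C : coalgebra K) (hbasic : basic C)
    (I : Type) (S E : I -> comodule C)
    (hS : complete_simples S)
    (hE : forall x, injective_envelope (S x) (E x))
    (hconn : connected_quiver S)
    (e : conv_idempotent C)
    (Ebar : I -> comodule (corner e))
    (hEbar : forall x, ~ torsion e (S x) ->
       injective_envelope (Tfun e (S x)) (Ebar x)) :
  let I_e := fun x => ~ torsion e (S x) in
  [<-> (* a *) stable e;
       (* b *) forall x, ~ I_e x -> torsion e (E x);
       (* c *) forall x, (I_e x -> cisom (Tfun e (E x)) (Ebar x)) /\
                         (~ I_e x -> torsion e (E x));
       (* d *) forall x y, I_e x -> ~ I_e y ->
                 forall f : chom (E y) (E x), forall m, f m = 0;
       (* e *) forall x, ~ I_e x -> ~ exists2 y, I_e y & predecessor S E y x;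
       (* f *) right_link_closed S (fun x => T_fixes e (S x));
       (* g *) ~ exists x y, [/\ path_in_quiver S x y, T_fixes e (S x) &
                                 torsion e (S y)];
       (* h *) left_semicentral e]
  /\
  (forall H : left_adjoint e,
     stable e <-> (* i *) forall x, I_e x -> cisom (H (Tfun e (S x))) (S x)).
Proof.
move=> I_e.
have nI x : ~ I_e x <-> torsion e (S x) by split=> [/contrapT|h nt]; [|exact: nt].
have fix_I x : I_e x <-> T_fixes e (S x).
  by split; [exact: not_torsion_T_fixes | exact: T_fixes_not_torsion].
have b_closed : (forall x, ~ I_e x -> torsion e (E x)) -> eact_closed e.
  by move=> h; apply: (torsion_env_eact_closed hS hE hbasic) => x /nI; exact: h.
have a_b : stable e -> forall x, ~ I_e x -> torsion e (E x).
  by move=> h x /nI; exact: h.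
have closed_b : eact_closed e -> forall x, ~ I_e x -> torsion e (E x).
  by move=> /semicentral_stable; exact: a_b.
have noarr_closed : (forall x y, arrow S x y -> T_fixes e (S x) -> ~ torsion e (S y)) ->
    eact_closed e.
  move=> h; apply: b_closed => x /nI.
  exact: (no_arrow_torsion_env hS hE hbasic h).
split; last first.
  move=> H; split=> [/a_b/b_closed h x /fix_I|h]; first exact: ladj_T_cisom.
  (* Under (i), the extension behind an arrow from a torsion-free vertex to a torsion one would
     split. *)
  apply: semicentral_stable; apply: noarr_closed => x y [X nX] fx ty; apply: nX.
  apply: (ladj_split_torsion_ext (H := H)) => //; first exact: simple_S hS x.
  by apply: h; apply/fix_I.
tfae.
- exact: a_b.
- move=> h x; split; last exact: h.
  (* T preserves injective envelopes here, so T(E_x) and [Ebar x] are both envelopes of T(S_x). *)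
  move=> Ix; apply: injective_envelope_uniq (hEbar x Ix).
  exact: (T_injective_envelope (b_closed h)).
- move=> h x y Ix /nI ty; apply: (torsion_env_Hom_zero hS hE hbasic) Ix ty.
  by move=> z /nI; exact: (h z).2.
(* By (d) the comodule [E x] is torsion, hence so is [loewy (E x) n] for every [n], and all
   extensions of a torsion-free simple comodule by it split. *)
- move=> h x /nI tx [y /fix_I fy [n [_ [X nX]]]]; apply: nX.
  have t_env : forall x, torsion e (S x) -> torsion e (E x).
    by apply: (Hom_zero_torsion_env hS hE) => u v Iu /nI; exact: h.
  apply: split_torsion_ext fy => //.
    by apply: b_closed => z /nI; exact: t_env.
  have /torsionP tE := t_env x tx; apply/torsionP => m; apply: val_inj.
  by rewrite [LHS](subcom_act e) linear0; exact: tE.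
- move=> h x y arr fx; apply: contrapT => nfy.
  have ty := not_T_fixes_torsion hS hbasic nfy.
  apply: (h y); first exact/nI.
  exists x; first exact/fix_I.
  (* [loewy (E y) 1] is the socle of [E y], a copy of [S y], so an arrow makes its source a
     1-predecessor of its target. *)
  exists 1%N; split=> //; have [_ [j [j_inj j_ess]]] := hE y.
  apply: Ext1_neq0_cisom arr; apply: (soc_essential _ j_inj j_ess); exact: simple_S hS y.
- move=> h [x [y [p fx ty]]]; apply: (T_fixes_not_torsion hS _ ty).
  by elim: p fx {ty} => [u v uv|//|u v w _ ih1 _ ih2] fu;
    [exact: h uv fu | exact/ih2/ih1].
- move=> h; apply: eact_semicentral; apply: noarr_closed => x y arr fx ty.
  by apply: h; exists x, y; split=> //; exact: Relation_Operators.rt_step.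
- by move=> /semicentral_eact; exact: semicentral_stable.
Qed.
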